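(* Let $(X_t)_{t\ge0}$ be an ergodic birth–death process on $\mathbb{N}=\{0,1,2,\dots\}$ with birth rates $(\lambda_x)_{x\ge0}$, death rates $(\nu_x)_{x\ge0}$ and stationary distribution $\pi$. Let $u$ be a positive function on $\mathbb{N}$ (with the convention $u_{-1}:=1$) and let $\delta$ be the metric on $\mathbb{N}$ given by $\delta(x,y)=\left|\sum_{k=0}^{x-1}u_k-\sum_{k=0}^{y-1}u_k\right|$. Assume that $P_t(x,\cdot)\in\mathscr{P}_\delta(\mathbb{N})$ for all $t>0$, $x\in\mathbb{N}$, that the Wasserstein curvature of the process with respect to $\delta$, which is given by $$\sigma_\delta=\inf_{x\in\mathbb{N}}\left\{\nu_{x+1}+\lambda_x-\nu_x\frac{u_{x-1}}{u_x}-\lambda_{x+1}\frac{u_{x+1}}{u_x}\right\},$$ is positive, and that there exist two constants $K>0$ and $C>0$ such that $$\min\Big\{\inf_{x\ge0}\lambda_x,\ \inf_{x\ge1}\nu_x\Big\}\ge K\quad\text{and}\quad u_x\le C\min\left\{\frac{1}{\sqrt{\nu_{x+1}}},\frac{1}{\sqrt{\lambda_x}}\right\},\qquad x\in\mathbb{N}.$$ Let $\phi\in\mathrm{Lip}_\delta(\mathbb{N})$. Then for any initial state $x\in\mathbb{N}$, any $t>0$ and any $y>0$, $$\mathbb{P}_x\left(\left|\frac1t\int_0^t\phi(X_s)\,\mathrm{d}s-\pi(\phi)\right|\ge y+M_t^x\right)\le 2\exp\left\{-2Kt\,g\!\left(\frac{y\,\sigma_\delta}{2\sqrt{K}\,C\,(1-e^{-\sigma_\delta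 t})\|\phi\|_{\mathrm{Lip}_\delta}}\right)\right\},$$ where $\pi(\phi)=\sum_{z\in\mathbb{N}}\phi(z)\pi(z)$, $g(v)=(1+v)\log(1+v)-v$ for $v>0$, and $$M_t^x:=\frac{(1-e^{-\sigma_\delta t})\|\phi\|_{\mathrm{Lip}_\delta}}{\sigma_\delta t}\sum_{z\in\mathbb{N}}\delta(x,z)\pi(z).$$
   Context: Birth–death process: $(X_t)_{t\ge0}$ is the $\mathbb{N}$-valued càdlàg Markov jump process with generator, for $f:\mathbb{N}\to\mathbb{R}$, $$\mathcal{L}f(x)=\lambda_x(f(x+1)-f(x))+\nu_x(f(x-1)-f(x)),\qquad x\in\mathbb{N},$$ where $\lambda_x>0$ for all $x\ge0$, $\nu_x>0$ for all $x\ge1$, and $\nu_0=0$. Its transition kernel is stable and conservative. It is ergodic in the sense that, with $\mu(0)=1$ and $\mu(x)=\frac{\lambda_0\lambda_1\cdots\lambda_{x-1}}{\nu_1\nu_2\cdots\nu_x}$ for $x\ge1$, $$\sum_{x\ge0}\mu(x)\sum_{y\ge x}\frac{1}{\mu(y)\lambda_y}=+\infty,\qquad Z:=\sum_{x\ge0}\mu(x)<+\infty,$$ and its stationary distribution is $\pi(x)=\mu(x)/Z$, $x\in\mathbb{N}$. $\mathbb{P}_x$ is the law of the process started at $x$; $P_t(x,\cdot)=\mathbb{P}_x(X_t\in\cdot)$ and $P_tf(x)=\mathbb{E}_x[f(X_t)]$. $\mathscr{P}_\delta(\mathbb{N})$ is the set of probability measures $m$ on $\mathbb{N}$ with $\sum_{y}\delta(x,y)m(y)<+\infty$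 for some (equivalently all) $x$. For $f:\mathbb{N}\to\mathbb{R}$, $\|f\|_{\mathrm{Lip}_\delta}:=\sup_{x\neq y}|f(x)-f(y)|/\delta(x,y)$, and $\mathrm{Lip}_\delta(\mathbb{N})$ is the set of $f$ for which this is finite. Wasserstein curvature: let $\bar\sigma_\delta(t):=-\sup\{\log\|P_tf\|_{\mathrm{Lip}_\delta}:\|f\|_{\mathrm{Lip}_\delta}=1\}$ for $t\ge0$, with $\bar\sigma_\delta(0)=0$. Then $\sigma_\delta:=\lim_{t\downarrow0}\bar\sigma_\delta(t)/t=\inf_{t>0}\bar\sigma_\delta(t)/t$; equivalently it is the best (maximal) constant $\alpha$ such that $\|P_tf\|_{\mathrm{Lip}_\delta}\le e^{-\alpha t}\|f\|_{\mathrm{Lip}_\delta}$ for all $f\in\mathrm{Lip}_\delta(\mathbb{N})$, $t>0$. It is a known fact that if $\sigma_\delta>0$ then the unique stationary distribution $\pi$ belongs to $\mathscr{P}_\delta(\mathbb{N})$. Conventions: empty sums are $0$; if $\|\phi\|_{\mathrm{Lip}_\delta}=0$, the right-hand side of the inequality is read as $0$. *)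

(* Defs.v *)
From HB Require Import structures.
From mathcomp Require Import all_boot all_order all_algebra.
From mathcomp Require Import all_classical all_reals all_analysis.

Set Implicit Arguments.
Unset Strict Implicit.
Unset Printing Implicit Defensive.

Import Order.TTheory GRing.Theory Num.Theory.
Import numFieldNormedType.Exports.

Local Open Scope classical_set_scope.
Local Open Scope ring_scope.

Record birth_death_rates (R : realType) (lam nu : nat -> R) : Prop := {
  bd_birth_gt0 : forall x, 0 < lam x ;
  bd_death_gt0 : forall x, 0 < nu x.+1 ;
  bd_death0 : nu 0%N = 0 }.

(* At x = 0 the value f (x - 1) is multiplied by nu 0 = 0, so that the
   convention 0.-1 = 0 is immaterial. *)
Definition bd_generator (R : realType) (lam nu : nat -> R) (f : nat -> R)
    (x : nat) : R :=
  lam x * (f x.+1 - f x) + nu x * (f x.-1 - f x).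

Definition bd_weight (R : realType) (lam nu : nat -> R) (x : nat) : R :=
  (\prod_(k < x) lam k) / (\prod_(k < x) nu k.+1).

Definition bd_mass (R : realType) (lam nu : nat -> R) : \bar R :=
  (\sum_(x <oo) (bd_weight lam nu x)%:E)%E.

Definition bd_ergodic (R : realType) (lam nu : nat -> R) : Prop :=
  (\sum_(x <oo) ((bd_weight lam nu x)%:E *
     \sum_(x <= y <oo) ((bd_weight lam nu y * lam y)^-1)%:E))%E = +oo%E
  /\ (bd_mass lam nu < +oo)%E.

Definition bd_stationary (R : realType) (lam nu : nat -> R) (x : nat) : R :=
  bd_weight lam nu x / fine (bd_mass lam nu).

(* Processes are indexed by all of R, but only the times t >= 0 matter:
   nothing below depends on X t for t < 0. *)

Definition semigroup (R : realType) (d : measure_display)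
    (Omega : measurableType d) (P : nat -> probability Omega R)
    (X : R -> {mfun Omega >-> nat}) (t : R) (f : nat -> R) (x : nat) : R :=
  fine ('E_(P x)[fun w => f (X t w)])%E.

Definition natural_filtration (R : realType) (d : measure_display)
    (Omega : measurableType d) (X : R -> {mfun Omega >-> nat}) (t : R) :
    set (set Omega) :=
  <<s [set A | exists s (B : set nat), 0 <= s <= t /\ A = X s @^-1` B] >>.

(* P x is the law under which the process starts at x. Continuity of the paths
   refers to the discrete topology of nat, so a left limit is a natural number
   and paths do not explode. The limit of (P_t f - f) / t, required for every
   bounded f, says that the transition function has the (stable and
   conservative) Q-matrix of the birth-death generator. *)
Record birth_death_process (R : realType) (d : measure_display)
    (Omega : measurableType d) (lam nu : nat -> R)
    (P : nat -> probability Omega R) (X : R -> {mfun Omega >-> nat}) : Prop := {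
  bd_start : forall x, P x (X 0 @^-1` [set x]) = 1%E ;
  bd_right_continuous : forall w (t : R), 0 <= t ->
    X s w @[s --> t^'+] --> X t w ;
  bd_left_limits : forall w (t : R), 0 < t -> cvg (X s w @[s --> t^'-]) ;
  bd_markov : forall x (s t : R) (A : set Omega) (y : nat),
    0 <= s -> 0 <= t -> natural_filtration X s A ->
    P x (A `&` X (s + t) @^-1` [set y]) =
      (\int[P x]_(w in A) P (X s w) (X t @^-1` [set y]))%E ;
  bd_has_generator : forall (f : nat -> R) x, bounded_fun f ->
    (semigroup P X t f x - f x) / t @[t --> (0 : R)^'+] -->
      bd_generator lam nu f x }.

Definition path_metric (R : realType) (u : nat -> R) (x y : nat) : R :=
  `| \sum_(k < x) u k - \sum_(k < y) u k |.

Definition wasserstein_space (R : realType) (delta : nat -> nat -> R) :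
    set (probability nat R) :=
  [set m | exists x, (\sum_(y <oo) (delta x y)%:E * m [set y] < +oo)%E].

Definition lip_norm (R : realType) (delta : nat -> nat -> R) (f : nat -> R) :
    \bar R :=
  ereal_sup [set e | exists x y : nat,
    x != y /\ e = (`| f x - f y | / delta x y)%:E].

Definition wasserstein_rate (R : realType) (d : measure_display)
    (Omega : measurableType d) (delta : nat -> nat -> R)
    (P : nat -> probability Omega R) (X : R -> {mfun Omega >-> nat}) (t : R) :
    \bar R :=
  (- ereal_sup [set lne (lip_norm delta (semigroup P X t f)) |
                f in [set f | lip_norm delta f = 1]])%E.

Definition wasserstein_curvature (R : realType) (d : measure_display)
    (Omega : measurableType d) (delta : nat -> nat -> R)
    (P : nat -> probability Omega R) (X : R -> {mfun Omega >-> nat}) : \bar R :=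
  lim ((wasserstein_rate delta P X t * (t^-1)%:E)%E @[t --> (0 : R)^'+]).

(* u_(x-1), with the convention u_(-1) = 1 *)
Definition upred (R : realType) (u : nat -> R) (x : nat) : R :=
  if x is k.+1 then u k else 1.

Definition bd_curvature_at (R : realType) (lam nu u : nat -> R) (x : nat) : R :=
  nu x.+1 + lam x - nu x * (upred u x / u x) - lam x.+1 * (u x.+1 / u x).

Definition poisson_rate (R : realType) (v : R) : R := (1 + v) * ln (1 + v) - v.

Definition time_average (R : realType) (d : measure_display)
    (Omega : measurableType d) (X : R -> {mfun Omega >-> nat})
    (phi : nat -> R) (t : R) (w : Omega) : R :=
  t^-1 * \int[@lebesgue_measure R]_(s in `[0, t]) phi (X s w).

(* Main.v *)
Require Import Defs.
From HB Require Import structures.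
From mathcomp Require Import all_boot all_order all_algebra.
From mathcomp Require Import all_classical all_reals all_analysis.
From mathcomp Require Import measurable_realfun.
From mathcomp Require Import ring lra.

Set Implicit Arguments.
Unset Strict Implicit.
Unset Printing Implicit Defensive.

Import Order.TTheory GRing.Theory Num.Theory.
Import numFieldNormedType.Exports.

Local Open Scope classical_set_scope.
Local Open Scope ring_scope.

(** Write S for the integral of phi (X_s) over [0, t], L for the Lipschitz
constant of phi, and theta = (1 - exp (- sigma t)) / sigma.

The idea is that S is the endpoint of a martingale with small jumps.  Given the
path up to time s, the conditional expectation of S is the integral of phi over
[0, s] plus F_(t-s) (X_s), where F_r is the integral of P_q phi for q in [0, r].
Positive curvature means that P_q contracts Lipschitz constants by
exp (- sigma q), so that F_r is theta L-Lipschitz.  A jump between z and z + 1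
therefore moves the martingale by at most theta L u_z, which is at most
b = theta L C / sqrt K, and the rates times the squared jumps add up to at most
2 (theta L C)^2 = 2 K b^2, since lam_z u_z^2 and nu_(z+1) u_z^2 are at most C^2.
Bennett's argument gives
  E_x exp (tau (S - E_x S)) <= exp (2 K t (exp (tau b) - 1 - tau b)),
and Chernoff's bound with tau b = ln (1 + v), v = y / (2 K b), yields
[poisson_rate].  The centring costs M: as pi is invariant, E_x phi
(X_s) differs from pi (phi) by at most exp (- sigma s) L sum_z delta (x, z) pi z,
and integrating over [0, t] gives t M.  The same bound for - phi provides the
second tail.

Two points need care.  The rates may be unbounded, and the generator is only
known as a pointwise limit on bounded functions, which is uniform over bounded
sets of functions but not over states ([generator_uniform]).  So the martingale
argument is run on the times h, 2h, ..., for the process killed above a level N: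
[one_step] is the exponential inequality for one step, [skeleton_exp_le] its
iteration.  Letting h tend to 0 turns Riemann sums into S ([riemann_sum_cvg]),
and letting N tend to infinity removes the killing because a path with left and
right limits is bounded on [0, t] ([skeleton_exceeds_cvg]).  Functions phi that
are not bounded are reached by truncation and Fatou's lemma
([laplace_lipschitz]).

The other point is that pi is invariant and has a finite first moment.
Invariance ([weight_invariant]) comes from detailed balance: for bounded f, the
sum over z <= N of mu z (P_T f - f) z is the flux mu N lam N (g (N+1) - g N) of a
bounded function g, and a flux with a nonzero limit would make the series of
1 / (mu lam) converge, which ergodicity excludes.  The moment
([stationary_truncated_moment]) follows by contracting truncated distances. *)

(** * The exponential remainder *)

Section exponential_remainder.
Context {R : realType}.
Implicit Types a z : R.

(** The power series are compared termwise: for k >= 2 one has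
a^2 |z|^k <= z^2 a^k.  Hence (e^z - 1 - z) / z^2 is at most its value at a, which
trades the remainder of a jump of size z for its square. *)
Lemma expR_remainder_le a z : `|z| <= a ->
  a ^+ 2 * (expR z - 1 - z) <= z ^+ 2 * (expR a - 1 - a).
Proof.
move=> za.
have a0 : 0 <= a by rewrite (le_trans _ za).
have cv (x : R) : series (exp_coeff x) n @[n --> \oo] --> expR x.
  exact: is_cvg_series_exp_coeff.
have cvr (b x : R) : b ^+ 2 * (series (exp_coeff x) n - 1 - x) @[n --> \oo] -->
    b ^+ 2 * (expR x - 1 - x).
  by apply: cvgMr; apply: cvgB; [apply: cvgB; [exact: cv|exact: cvg_cst]|exact: cvg_cst].
suff key n : (2 <= n)%N -> a ^+ 2 * (series (exp_coeff z) n - 1 - z) <=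
    z ^+ 2 * (series (exp_coeff a) n - 1 - a).
  apply: (ler_cvg_to (cvr _ _) (cvr _ _)).
  by exists 2%N => // n /= n2; exact: key.
case: n => [//|[//|n _]].
have E (x : R) : series (exp_coeff x) n.+2 - 1 - x =
    \sum_(k < n) x ^+ k.+2 / k.+2`!%:R.
  rewrite /series /exp_coeff /= 2?big_nat_recl//= big_mkord.
  rewrite expr0 expr1 fact0 (_ : 1`! = 1%N)// !divr1.
  by rewrite [1 + _]addrC addrK [x + _]addrC addrK.
rewrite !E !mulr_sumr; apply: ler_sum => k _.
have e2D (b : R) : b ^+ k.+2 = b ^+ 2 * b ^+ k by exact: (exprD b 2 k).
rewrite !(mulrA (_ ^+ 2) _ (_^-1)) ler_wpM2r ?invr_ge0 ?ler0n//.
rewrite !e2D mulrCA ler_wpM2l ?exprn_even_ge0//.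
rewrite ler_wpM2l ?exprn_ge0//.
by rewrite (le_trans (ler_norm _))// normrX lerXn2r ?nnegrE.
Qed.

End exponential_remainder.

(** * Markov semigroups on bounded functions *)

Section markov_semigroup.
Context {R : realType}.
Implicit Types (f g : nat -> R) (M t h : R) (x y : nat).

Definition bounded_by M f := forall x, `|f x| <= M.

(** All laws concern bounded functions, on which the expectations
defining the semigroup of a process are integrals of integrable functions. *)
Record markov_semigroup (Q : R -> (nat -> R) -> nat -> R) : Prop := {
  ms_linear : forall t f g M N a x, 0 <= t -> bounded_by M f ->
    bounded_by N g ->
    Q t (fun y => f y + a * g y) x = Q t f x + a * Q t g x ;
  ms_mono : forall t f g M N x, 0 <= t -> bounded_by M f -> bounded_by N g ->
    (forall y, f y <= g y) -> Q t f x <= Q t g x ;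
  ms_conservative : forall t (c : R) x, 0 <= t -> Q t (fun=> c) x = c ;
  ms_add : forall s t f M x, 0 <= s -> 0 <= t -> bounded_by M f ->
    Q (s + t) f x = Q s (Q t f) x }.

Lemma bounded_by_cst (c : R) : bounded_by `|c| (fun=> c). Proof. by []. Qed.

Lemma bounded_by_ge0 M f : bounded_by M f -> 0 <= M.
Proof. by move=> /(_ 0%N); apply: le_trans. Qed.

Lemma bounded_byD M N f g : bounded_by M f -> bounded_by N g ->
  bounded_by (M + N) (fun y => f y + g y).
Proof. by move=> fM gN y; rewrite (le_trans (ler_normD _ _))// lerD. Qed.

Lemma bounded_byZ M f (a : R) : bounded_by M f ->
  bounded_by (`|a| * M) (fun y => a * f y).
Proof. by move=> fM y; rewrite normrM ler_wpM2l. Qed.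

Lemma bounded_byN M f : bounded_by M f -> bounded_by M (fun y => - f y).
Proof. by move=> fM y; rewrite normrN. Qed.

Lemma bounded_byB M N f g : bounded_by M f -> bounded_by N g ->
  bounded_by (M + N) (fun y => f y - g y).
Proof. by move=> fM gN; apply: bounded_byD => //; exact: bounded_byN. Qed.

Lemma bounded_by_fun M f : bounded_by M f -> bounded_fun f.
Proof.
move=> fM; exists M; split; first exact: num_real.
by move=> z Mz y _ /=; rewrite (le_trans (fM y))// ltW.
Qed.

Lemma bounded_by_bool (b : pred nat) : bounded_by 1 (fun y => (b y)%:R).
Proof. by move=> y; case: (b y); rewrite ?normr1 ?normr0. Qed.

Context {Q : R -> (nat -> R) -> nat -> R} (mQ : markov_semigroup Q).

Lemma ms_bounded t f M : 0 <= t -> bounded_by M f -> bounded_by M (Q t f).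
Proof.
move=> t0 fM x; rewrite ler_norml; apply/andP; split.
  rewrite -(ms_conservative mQ (- M) x t0).
  apply: (ms_mono mQ _ t0 (bounded_by_cst _) fM) => y.
  by have := fM y; rewrite ler_norml => /andP[].
rewrite -(ms_conservative mQ M x t0).
apply: (ms_mono mQ _ t0 fM (bounded_by_cst _)) => y.
by have := fM y; rewrite ler_norml => /andP[].
Qed.

Lemma msD t f g M N x : 0 <= t -> bounded_by M f -> bounded_by N g ->
  Q t (fun y => f y + g y) x = Q t f x + Q t g x.
Proof.
move=> t0 fM gN; have := ms_linear mQ 1 x t0 fM gN.
by rewrite mul1r => <-; congr (Q _ _ _); apply/funext => y; rewrite mul1r.
Qed.

Lemma msZ t f M (a : R) x : 0 <= t -> bounded_by M f ->
  Q t (fun y => a * f y) x = a * Q t f x.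
Proof.
move=> t0 fM; have := ms_linear mQ a x t0 (bounded_by_cst 0) fM.
rewrite (ms_conservative mQ)// add0r => <-.
by congr (Q _ _ _); apply/funext => y; rewrite add0r.
Qed.

Lemma ms_norm t f g M N x : 0 <= t -> bounded_by M f -> bounded_by N g ->
  (forall y, `|f y| <= g y) -> `|Q t f x| <= Q t g x.
Proof.
move=> t0 fM gN fg; rewrite ler_norml; apply/andP; split.
  rewrite -mulN1r -(msZ _ _ t0 gN).
  apply: (ms_mono mQ _ t0 (bounded_byZ _ gN) fM) => y.
  by rewrite mulN1r; have := fg y; rewrite ler_norml => /andP[].
by apply: (ms_mono mQ _ t0 fM gN) => y; rewrite (le_trans (ler_norm _)).
Qed.

Lemma ms_iter h f M n x : 0 <= h -> bounded_by M f ->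
  iter n.+1 (Q h) f x = Q (n.+1%:R * h) f x.
Proof.
move=> h0 fM; elim: n x => [|n IH] x; first by rewrite mul1r.
rewrite iterS (_ : iter n.+1 (Q h) f = Q (n.+1%:R * h) f); last exact/funext.
rewrite -(ms_add mQ _ h0 _ fM) ?mulr_ge0//.
by rewrite [in RHS]mulrSr mulrDl mul1r [in RHS]addrC.
Qed.

Lemma ms_iter_bounded h f M n : 0 <= h -> bounded_by M f ->
  bounded_by M (iter n (Q h) f).
Proof. by move=> h0 fM; elim: n => //= n IH; exact: ms_bounded. Qed.

(** The discrete Feynman-Kac semigroup applied to 1.  When Q is the
semigroup of X, this is the expectation under P x of
a (X_h) * a (X_(2h)) * ... * a (X_(nh)), see [skeleton_expectation]. *)
Definition skeleton h (a : nat -> R) (n : nat) : nat -> R :=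
  iter n (fun V => Q h (fun y => a y * V y)) (fun=> 1).

Lemma skeleton_bounded h a M n : 0 <= h -> bounded_by M a ->
  exists N, bounded_by N (skeleton h a n).
Proof.
move=> h0 aM; elim: n => [|n [N IH]]; first by exists 1 => y; rewrite normr1.
exists (M * N); apply: ms_bounded => // y.
by rewrite normrM ler_pM.
Qed.

Lemma skeleton_ge0 h a M n x : 0 <= h -> bounded_by M a ->
  (forall y, 0 <= a y) -> 0 <= skeleton h a n x.
Proof.
move=> h0 aM a0; elim: n x => [|n IH] x //.
rewrite /skeleton iterS -(ms_conservative mQ 0 x h0).
have [N bN] := skeleton_bounded n h0 aM.
have b : bounded_by (M * N) (fun y => a y * skeleton h a n y).
  by move=> y; rewrite normrM ler_pM.
by apply: (ms_mono mQ _ h0 (bounded_by_cst 0) b) => y; rewrite mulr_ge0.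
Qed.

End markov_semigroup.
Arguments skeleton {R} Q h a n.

Section birth_death_semigroup.
Context {R : realType} {lam nu : nat -> R} {Q : R -> (nat -> R) -> nat -> R}.
Hypothesis mQ : markov_semigroup Q.
Hypothesis gQ : forall (f : nat -> R) x, bounded_fun f ->
  (Q t f x - f x) / t @[t --> (0 : R)^'+] --> bd_generator lam nu f x.
Implicit Types (f g : nat -> R) (M t h : R) (x y : nat).

Lemma generator_eps f M x (e : R) : bounded_by M f -> 0 < e ->
  exists2 h0, 0 < h0 & forall h, 0 < h < h0 ->
    `|Q h f x - f x - h * bd_generator lam nu f x| <= e * h.
Proof.
move=> fM e0; have /cvgrPdist_le /(_ e e0) := gQ (x := x) (bounded_by_fun fM).
rewrite near_withinE => -[r /= r0 H]; exists r => // h /andP[h0 hr].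
have := H h; rewrite /= sub0r normrN gtr0_norm// => /(_ hr h0).
rewrite distrC -(ler_pM2r h0); apply: le_trans.
set L := bd_generator _ _ _ _.
rewrite (_ : _ - h * L = ((Q h f x - f x) / h - L) * h).
  by rewrite normrM (gtr0_norm h0).
by rewrite mulrBl divfK ?gt_eqF// [h * _]mulrC.
Qed.

(** Testing the generator on the indicators of x + 1, of x - 1 and
of all remaining points shows that, up to a mass o(h), the law at time h is carried
by x and its neighbours.  So the speed of convergence depends on g only through its
bound, and g may vary with h. *)
Lemma generator_uniform x (e : R) : 0 < e ->
  exists2 h0, 0 < h0 & forall h g M, 0 < h < h0 -> bounded_by M g ->
    `|Q h g x - g x - h * bd_generator lam nu g x| <= e * h * M.
Proof.
move=> e0; have e60 : 0 < e / 6 by rewrite divr_gt0.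
pose e1 y : R := (y == x.+1)%:R.
pose e2 y : R := (y == x.-1)%:R.
pose e3 y : R := [&& y != x, y != x.+1 & y != x.-1]%:R.
have b1 : bounded_by 1 e1 by exact: (bounded_by_bool (fun y => y == x.+1)).
have b2 : bounded_by 1 e2 by exact: (bounded_by_bool (fun y => y == x.-1)).
have b3 : bounded_by 1 e3.
  exact: (bounded_by_bool (fun y => [&& y != x, y != x.+1 & y != x.-1])).
have [h1 h10 H1] := generator_eps x b1 e60.
have [h2 h20 H2] := generator_eps x b2 e60.
have [h3 h30 H3] := generator_eps x b3 e60.
exists (Num.min h1 (Num.min h2 h3)); first by rewrite !lt_min h10 h20.
move=> h g M /andP[h0]; rewrite !lt_min => /and3P[hh1 hh2 hh3] gM.
have hge0 := ltW h0.
have M0 := bounded_by_ge0 gM.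
have {H1}A1 : `|Q h e1 x - h * lam x| <= e / 6 * h.
  have := H1 h; rewrite h0 hh1 => /(_ isT); rewrite /bd_generator /e1 eqxx.
  by rewrite !(ltn_eqF (ltnSn _), ltn_eqF (leq_ltn_trans (leq_pred x) (ltnSn x))) !subr0 mulr0 addr0 mulr1.
have {H3}A3 : `|Q h e3 x| <= e / 6 * h.
  have := H3 h; rewrite h0 hh3 => /(_ isT); rewrite /bd_generator /e3 !eqxx /=.
  by rewrite !andbF !subr0 !mulr0 addr0 mulr0 subr0.
set a1 := g x.+1 - g x; set a2 := g x.-1 - g x.
have a1M : `|a1| <= 2 * M by rewrite mulrDl mul1r (le_trans (ler_normB _ _))// lerD.
have a2M : `|a2| <= 2 * M by rewrite mulrDl mul1r (le_trans (ler_normB _ _))// lerD.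
have {H2}A2 : `|a2 * (Q h e2 x - h * nu x)| <= 2 * M * (e / 6 * h).
  have [x0|x0] := eqVneq x 0%N.
    by rewrite /a2 x0 subrr mul0r normr0 !mulr_ge0// ?invr_ge0// ltW.
  rewrite normrM ler_pM//.
  have := H2 h; rewrite h0 hh2 => /(_ isT); rewrite /bd_generator /e2 eqxx.
  have x1 : (x.-1 < x)%N by rewrite prednK ?lt0n.
  by rewrite (gtn_eqF x1) (gtn_eqF (ltn_trans x1 (ltnSn _))) !subr0 mulr0 add0r mulr1.
pose r y := g y - (g x + a1 * e1 y + a2 * e2 y).
have b12 := bounded_byD (bounded_byD (bounded_by_cst (g x)) (bounded_byZ a1 b1)) (bounded_byZ a2 b2).
have br := bounded_byB gM b12.
have re3 y : `|r y| <= (2 * M) * e3 y.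
  rewrite /r /e3 /e1 /e2.
  have [->/=|yx] := eqVneq y x.
    rewrite (ltn_eqF (ltnSn _)) mulr0 addr0 mulr0.
    have [xx|_] := eqVneq x x.-1; last by rewrite mulr0 addr0 subrr normr0.
    by rewrite /a2 -xx subrr mul0r addr0 subrr normr0.
  have [->/=|yx1] := eqVneq y x.+1.
    rewrite (gtn_eqF (leq_ltn_trans (leq_pred x) (ltnSn x))) mulr0 addr0 mulr1 mulr0.
    by rewrite /a1 [g x + _]addrC subrK subrr normr0.
  have [->/=|yx2] := eqVneq y x.-1.
    by rewrite !mulr0 mulr1 addr0 /a2 [g x + _]addrC subrK subrr normr0.
  rewrite /= !mulr0 !addr0 mulr1 mulrDl mul1r.
  by rewrite (le_trans (ler_normB _ _))// lerD.
have Qr : `|Q h r x| <= 2 * M * (e / 6 * h).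
  apply: (le_trans (ms_norm mQ x hge0 br (bounded_byZ (2 * M) b3) re3)).
  rewrite (msZ mQ _ _ hge0 b3) ler_wpM2l ?mulr_ge0//.
  by rewrite (le_trans (ler_norm _)).
have Qg : Q h g x = g x + a1 * Q h e1 x + a2 * Q h e2 x + Q h r x.
  transitivity (Q h (fun y => (g x + a1 * e1 y + a2 * e2 y) + r y) x).
    by congr (Q _ _ _); apply/funext => y; rewrite /r addrC subrK.
  rewrite (msD mQ _ hge0 b12 br); congr (_ + _).
  rewrite (ms_linear mQ _ _ hge0 (bounded_byD (bounded_by_cst (g x)) (bounded_byZ a1 b1)) b2).
  by rewrite (ms_linear mQ _ _ hge0 (bounded_by_cst (g x)) b1) (ms_conservative mQ).
have -> : Q h g x - g x - h * bd_generator lam nu g x =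
    a1 * (Q h e1 x - h * lam x) + a2 * (Q h e2 x - h * nu x) + Q h r x.
  rewrite Qg /bd_generator -/a1 -/a2; ring.
have B1 : `|a1 * (Q h e1 x - h * lam x)| <= 2 * M * (e / 6 * h).
  by rewrite normrM ler_pM.
rewrite (_ : e * h * M = 2 * M * (e / 6 * h) + 2 * M * (e / 6 * h) + 2 * M * (e / 6 * h)); last by field.
by rewrite (le_trans (ler_normD _ _))// lerD// (le_trans (ler_normD _ _))// lerD.
Qed.

End birth_death_semigroup.

(** * Invariance of the reversible weights *)

Section nonnegative_series.
Context {R : realType}.
Implicit Types a : nat -> R.

Lemma series_bounded_cvgn a B : (forall n, 0 <= a n) ->
  (forall n, series a n <= B) -> cvgn (series a).
Proof.
move=> a0 aB; apply: nondecreasing_is_cvgn.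
  by apply/nondecreasing_seqP => n; rewrite /series /= big_nat_recr//= lerDl.
by exists B => _ [n _ <-].
Qed.

Lemma series_le_lim a n : (forall n, 0 <= a n) -> cvgn (series a) ->
  series a n <= limn (series a).
Proof.
move=> a0 ca; apply: nondecreasing_cvgn_le => //.
by apply/nondecreasing_seqP => k; rewrite /series /= big_nat_recr//= lerDl.
Qed.

Lemma cvg_series_fine a : (forall n, 0 <= a n) ->
  (\sum_(n <oo) (a n)%:E < +oo)%E ->
  series a n @[n --> \oo] --> fine (\sum_(n <oo) (a n)%:E)%E.
Proof.
move=> a0 afin.
have s0 : (0 <= \sum_(n <oo) (a n)%:E)%E.
  by apply: nneseries_ge0 => n _ _; rewrite lee_fin.
have ca : cvgn (series a).
  apply: (@series_bounded_cvgn _ (fine (\sum_(n <oo) (a n)%:E)%E)) => // n.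
  rewrite -lee_fin fineK ?ge0_fin_numE// /series /= -sumEFin.
  by apply: nneseries_lim_ge => k _ _; rewrite lee_fin.
rewrite (_ : (\sum_(n <oo) (a n)%:E)%E = (limn (series a))%:E)//=.
rewrite -EFin_lim//; congr (limn _).
by apply/funext => n /=; rewrite sumEFin.
Qed.

End nonnegative_series.

Section invariance.
Context {R : realType} {lam nu : nat -> R} {Q : R -> (nat -> R) -> nat -> R}.
Hypothesis mQ : markov_semigroup Q.
Hypothesis gQ : forall (f : nat -> R) x, bounded_fun f ->
  (Q t f x - f x) / t @[t --> (0 : R)^'+] --> bd_generator lam nu f x.
Hypothesis rates : birth_death_rates lam nu.
Hypothesis erg : bd_ergodic lam nu.
Implicit Types (f g : nat -> R) (M t h : R) (x y : nat).

Local Notation mu := (bd_weight lam nu).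
Local Notation L := (bd_generator lam nu).

Lemma weight_gt0 x : 0 < mu x.
Proof.
rewrite /bd_weight divr_gt0// prodr_gt0// => i _.
- exact: (bd_birth_gt0 rates).
- exact: (bd_death_gt0 rates).
Qed.

Lemma detailed_balance x : mu x.+1 * nu x.+1 = mu x * lam x.
Proof.
rewrite /bd_weight !big_ord_recr /=.
have B0 : \prod_(k < x) nu k.+1 != 0.
  by rewrite gt_eqF// prodr_gt0// => i _; exact: (bd_death_gt0 rates).
have b0 : nu x.+1 != 0 by rewrite gt_eqF//; exact: (bd_death_gt0 rates).
by field; rewrite ?B0 ?b0.
Qed.

Lemma cvg_mass : series mu n @[n --> \oo] --> fine (bd_mass lam nu).
Proof. by apply: cvg_series_fine => [n|]; [exact/ltW/weight_gt0|case: erg]. Qed.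

Lemma mass_gt0 : 0 < fine (bd_mass lam nu).
Proof.
have <- := cvg_lim (@Rhausdorff R) cvg_mass.
apply: (@lt_le_trans _ _ (series mu 1)).
  by rewrite /series /= big_nat1 weight_gt0.
apply: series_le_lim; first by move=> n; exact/ltW/weight_gt0.
by apply/cvg_ex; eexists; exact: cvg_mass.
Qed.

(** Detailed balance makes the sum telescope: only the flux through the
edge from N to N + 1 is left. *)
Lemma sum_generator f N :
  \sum_(x < N.+1) mu x * L f x = mu N * lam N * (f N.+1 - f N).
Proof.
elim: N => [|N IH].
  by rewrite big_ord1 /bd_generator (bd_death0 rates) mul0r addr0 mulrA.
rewrite big_ord_recr /= IH /bd_generator /= [X in _ + X]mulrDr.
rewrite [mu N.+1 * (nu N.+1 * _)]mulrA detailed_balance.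
by ring.
Qed.

(** A bound B on the partial sums would bound every tail, hence the double
series of the ergodicity condition by B times the total mass. *)
Lemma recurrence B : ~ (forall n, \sum_(y < n) (mu y * lam y)^-1 <= B).
Proof.
move=> HB; case: erg => + fm.
have pos y : 0 <= (mu y * lam y)^-1.
  by rewrite invr_ge0 ltW// mulr_gt0 ?weight_gt0//; exact: (bd_birth_gt0 rates).
suff : (\sum_(x <oo) ((mu x)%:E *
     \sum_(x <= y <oo) ((mu y * lam y)^-1)%:E) <= B%:E * bd_mass lam nu)%E.
  move=> H E; move: H; rewrite E leye_eq => /eqP BE; move: fm.
  have B0 : 0 <= B by have := HB 0%N; rewrite big_ord0.
  have m0 : (0 <= bd_mass lam nu)%E.
    by apply: nneseries_ge0 => n _ _; rewrite lee_fin ltW// weight_gt0.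
  move=> fm; move: BE; rewrite -(@fineK _ (bd_mass lam nu)) ?ge0_fin_numE// -EFinM.
rewrite -nneseriesZl; last by move=> n _; rewrite lee_fin ltW// weight_gt0.
apply: lee_nneseries => [i _ _|n _].
  apply: mule_ge0; first by rewrite lee_fin ltW ?weight_gt0.
  by apply: nneseries_ge0 => k _ _; rewrite lee_fin.
rewrite [leRHS]muleC lee_pmul2l ?lte_fin ?weight_gt0//.
apply: lime_le; first by apply: is_cvg_nneseries => k _ _; rewrite lee_fin.
apply: nearW => m; rewrite sumEFin lee_fin; apply: le_trans (HB m).
rewrite -(big_mkord xpredT (fun y => (mu y * lam y)^-1)).
have [nm|mn] := leqP n m; last by rewrite (big_geq (ltnW mn)) sumr_ge0.
by rewrite [leRHS](@big_cat_nat _ _ _ n)//= lerDr sumr_ge0.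
Qed.

Lemma generator_uniform_lt N (e : R) : 0 < e ->
  exists2 h0, 0 < h0 & forall h g M x, 0 < h < h0 -> bounded_by M g ->
    (x < N)%N -> `|Q h g x - g x - h * L g x| <= e * h * M.
Proof.
move=> e0; elim: N => [|N [h1 h10 H1]]; first by exists 1.
have [h2 h20 H2] := generator_uniform mQ gQ N e0.
exists (Num.min h1 h2); first by rewrite lt_min h10.
move=> h g M x /andP[h0]; rewrite lt_min => /andP[hh1 hh2] gM.
rewrite ltnS leq_eqVlt => /predU1P[->|xN]; first by apply: H2; rewrite ?h0.
by apply: H1; rewrite ?h0.
Qed.

Lemma step_lt (T h0 : R) : 0 < T -> 0 < h0 ->
  exists n0, forall n, (n0 <= n)%N -> 0 < T / n.+1%:R < h0.
Proof.
move=> T0 h00; exists (Num.truncn (T / h0)) => n n0n.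
rewrite divr_gt0 ?ltr0n//= ltr_pdivrMr ?ltr0n// mulrC -ltr_pdivrMr//.
rewrite (lt_le_trans (truncnS_gt _))// ler_nat.
by rewrite ltnS.
Qed.

Lemma generator_sum (F : nat -> nat -> R) h n x :
  h * L (fun y => \sum_(k < n) F k y) x = \sum_(k < n) h * L (F k) x.
Proof.
rewrite -mulr_sumr; congr (_ * _).
by rewrite /bd_generator -!sumrB !mulr_sumr -big_split.
Qed.

(** Here g is a Riemann sum of the integral of Q_s f over [0, T], so
that L g = Q_T f - f is the integrated backward equation.  For the Riemann sum the
right-hand side telescopes exactly and the error is that of [generator_uniform_lt]. *)
Lemma potential_approx T f M N (e : R) : 0 < T -> bounded_by M f -> 0 < e ->
  exists2 g, bounded_by (T * M) g & forall x, (x < N)%N ->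
    `|Q T f x - f x - L g x| <= e.
Proof.
move=> T0 fM e0.
have M0 := bounded_by_ge0 fM.
have TM0 : 0 < T * (M + 1) by rewrite mulr_gt0// ltr_wpDl.
have [h0 h00 H] := generator_uniform_lt N (divr_gt0 e0 TM0).
have [n /(_ _ (leqnn n))/andP[]] := step_lt T0 h00.
set h := T / n.+1%:R => hpos hh0.
have nhT : n.+1%:R * h = T by rewrite mulrC divfK// pnatr_eq0.
clearbody h.
have GM k := ms_iter_bounded mQ k (ltW hpos) fM.
exists (fun y => h * \sum_(k < n.+1) iter k (Q h) f y) => [x|x xN].
  rewrite normrM gtr0_norm// (_ : T * M = h * (n.+1%:R * M)).
    rewrite ler_wpM2l ?(ltW hpos)//.
    rewrite (le_trans (ler_norm_sum _ _ _))//.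
    rewrite (le_trans (ler_sum _ (fun (k : 'I_n.+1) _ => GM k x)))//.
    by rewrite sumr_const card_ord mulr_natl.
  by rewrite mulrA [h * _]mulrC nhT.
have -> : L (fun y => h * \sum_(k < n.+1) iter k (Q h) f y) x =
    \sum_(k < n.+1) h * L (iter k (Q h) f) x.
  by rewrite -generator_sum /bd_generator; ring.
have -> : Q T f x - f x =
    \sum_(k < n.+1) (iter k.+1 (Q h) f x - iter k (Q h) f x).
  rewrite -nhT -(ms_iter mQ _ _ (ltW hpos) fM).
  rewrite -(big_mkord xpredT (fun k => iter k.+1 (Q h) f x - iter k (Q h) f x)).
  by rewrite (telescope_sumr (fun k => iter k (Q h) f x)).
rewrite -sumrB (le_trans (ler_norm_sum _ _ _))//.
have hh : 0 < h < h0 by rewrite hpos.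
rewrite (le_trans (ler_sum _ (fun (k : 'I_n.+1) _ => H _ _ _ _ hh (GM k) xN)))//.
rewrite sumr_const card_ord -mulr_natl.
rewrite [leLHS](_ : _ = (n.+1%:R * h) * (e / (T * (M + 1)) * M)); last by ring.
rewrite nhT [leLHS](_ : _ = e * (M / (M + 1))); last first.
  by field; rewrite !gt_eqF// ltr_wpDl.
by rewrite ler_piMr ?(ltW e0)// ler_pdivrMr ?mul1r ?lerDl// ltr_wpDl.
Qed.

(** If W were positive, [sum_generator] applied to the function g
of [potential_approx] would force g to increase by at least (W / 4) / (mu y * lam y)
across every far edge.  As g is bounded, this contradicts [recurrence]. *)
Lemma weight_invariant_le T f M W : 0 < T -> bounded_by M f ->
  series (fun x => mu x * (Q T f x - f x)) n @[n --> \oo] --> W -> W <= 0.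
Proof.
move=> T0 fM cW; rewrite leNgt; apply/negP => W0.
have M0 := bounded_by_ge0 fM.
have W20 : 0 < W / 2 by rewrite divr_gt0.
have [N0 _ HN0] : \forall n \near \oo, W / 2 <=
    series (fun x => mu x * (Q T f x - f x)) n.
  have /cvgrPdist_le /(_ _ W20) := cW; apply: filterS => n.
  by rewrite ler_norml => /andP[_]; lra.
(* 2 * T * M bounds the oscillation of g, and W / 4 the flux from below: W / 2 for
   the partial sums beyond N0, minus the approximation error. *)
pose B := 4 / W * (2 * (T * M)).
have B0 : 0 <= B.
  by rewrite /B mulr_ge0 ?divr_ge0 ?(ltW W0)// mulr_ge0 ?mulr_ge0 ?(ltW T0).
have step N1 : \sum_(N0 <= y < N1) (mu y * lam y)^-1 <= B.
  pose S := \sum_(x < N1.+1) mu x.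
  have S0 : 0 < S.
    by rewrite /S big_ord_recl ltr_pwDl ?weight_gt0// sumr_ge0// => i _; exact/ltW/weight_gt0.
  have [g gT Hg] := potential_approx N1.+1 T0 fM (divr_gt0 W0 (mulr_gt0 (ltr0n R 4) S0)).
  have [N01|N10] := leqP N0 N1; last by rewrite (big_geq (ltnW N10)).
  apply: (@le_trans _ _ (\sum_(N0 <= y < N1) 4 / W * (g y.+1 - g y))).
    apply: ler_sum_nat => y /andP[N0y yN1].
    have ml0 : 0 < mu y * lam y.
      by rewrite mulr_gt0 ?weight_gt0//; exact: (bd_birth_gt0 rates).
    rewrite -[leLHS]mul1r ler_pdivrMr//.
    rewrite [leRHS](_ : _ = 4 / W * (mu y * lam y * (g y.+1 - g y))); last by ring.
    rewrite -sum_generator -ler_pdivrMl ?divr_gt0// mulr1 invf_div.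
    have Sy : \sum_(x < y.+1) mu x <= S.
      rewrite /S -!(big_mkord xpredT mu).
      rewrite [leRHS](@big_cat_nat _ _ _ y.+1)//=; last by rewrite ltnS ltnW.
      by rewrite lerDl sumr_ge0// => i _; exact/ltW/weight_gt0.
    have := HN0 y.+1 (leqW N0y); rewrite /series /= big_mkord => Hy.
    have D : \sum_(x < y.+1) mu x * (Q T f x - f x) -
        \sum_(x < y.+1) mu x * L g x <= W / (4 * S) * \sum_(x < y.+1) mu x.
      rewrite -sumrB mulr_sumr ler_sum// => x _.
      rewrite -mulrBr mulrC ler_wpM2r ?(ltW (weight_gt0 _))//.
      rewrite (le_trans (ler_norm _))// Hg//.
      by rewrite (leq_trans (ltn_ord x))// ltnW.
    have {}D := le_trans D (ler_wpM2l (ltW (divr_gt0 W0 (mulr_gt0 (ltr0n R 4) S0))) Sy).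
    have E : W / (4 * S) * S = W / 4 by field; rewrite gt_eqF.
    by rewrite E in D; lra.
  rewrite -mulr_sumr telescope_sumr// /B ler_wpM2l ?divr_ge0 ?(ltW W0)//.
  rewrite (le_trans (ler_norm _))// (le_trans (ler_normB _ _))//.
  by rewrite mulrDl mul1r lerD.
apply: (@recurrence (B + \sum_(y < N0) (mu y * lam y)^-1)) => n.
have pos y : 0 <= (mu y * lam y)^-1.
  by rewrite invr_ge0 ltW// mulr_gt0 ?weight_gt0//; exact: (bd_birth_gt0 rates).
rewrite -!(big_mkord xpredT (fun y => (mu y * lam y)^-1)).
have [N0n|nN0] := leqP N0 n.
  by rewrite (@big_cat_nat _ _ _ N0)//= addrC lerD2r step.
rewrite [in leRHS](@big_cat_nat _ _ _ n)//=; last exact: ltnW.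
by rewrite addrCA lerDl addr_ge0// sumr_ge0.
Qed.

Lemma cvg_series_bounded_by f M (a : nat -> R) : bounded_by M f ->
  (forall n, 0 <= a n) -> cvgn (series a) -> cvgn (series (fun n => a n * f n)).
Proof.
move=> fM a0 ca; apply: normed_cvg.
apply: (@series_le_cvg _ _ (fun n => M * a n)) => [n|n|n|].
- exact: normr_ge0.
- by rewrite mulr_ge0// (bounded_by_ge0 fM).
- by rewrite /= normrM (ger0_norm (a0 n)) mulrC ler_wpM2r.
- exact: is_cvg_seriesZ.
Qed.

Lemma weight_invariant T f M : 0 < T -> bounded_by M f ->
  series (fun x => mu x * (Q T f x - f x)) n @[n --> \oo] --> 0.
Proof.
move=> T0 fM.
have b2 := bounded_byB (ms_bounded mQ (ltW T0) fM) fM.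
have c : cvgn (series (fun x => mu x * (Q T f x - f x))).
  apply: (cvg_series_bounded_by b2) => [n|]; first exact/ltW/weight_gt0.
  by apply/cvg_ex; eexists; exact: cvg_mass.
move/cvg_ex : c => [W cW]; suff -> : 0 = W by [].
apply/eqP; rewrite eq_le (weight_invariant_le T0 fM cW) andbT -oppr_le0.
apply: (weight_invariant_le T0 (bounded_byN fM)).
have -> : series (fun x => mu x * (Q T (fun y => - f y) x - - f x)) =
    (fun n => - series (fun x => mu x * (Q T f x - f x)) n).
  apply/funext => n; rewrite /series /= -sumrN; apply: eq_bigr => x _.
  have := msZ mQ (-1) x (ltW T0) fM.
  rewrite (_ : (fun y => -1 * f y) = (fun y => - f y)); last first.
    by apply/funext => y; rewrite mulN1r.
  by move=> ->; rewrite mulN1r -opprD mulrN.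
exact: cvgN.
Qed.

End invariance.

(** * Convergence to equilibrium under contraction *)

Section curvature.
Context {R : realType} {lam nu u : nat -> R}.
Context {Q : R -> (nat -> R) -> nat -> R} {sigma : R}.
Hypothesis mQ : markov_semigroup Q.
Hypothesis gQ : forall (f : nat -> R) x, bounded_fun f ->
  (Q t f x - f x) / t @[t --> (0 : R)^'+] --> bd_generator lam nu f x.
Hypothesis rates : birth_death_rates lam nu.
Hypothesis erg : bd_ergodic lam nu.
Hypothesis sigma0 : 0 < sigma.
Implicit Types (f g : nat -> R) (M t h c : R) (x y : nat).

Local Notation mu := (bd_weight lam nu).
Local Notation pi := (bd_stationary lam nu).
Local Notation delta := (path_metric u).

Definition lipschitz_by (d : nat -> nat -> R) c f :=
  forall x y, `|f x - f y| <= c * d x y.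

Lemma path_metric_ge0 x y : 0 <= delta x y.
Proof. exact: normr_ge0. Qed.

Lemma path_metricxx x : delta x x = 0.
Proof. by rewrite /path_metric subrr normr0. Qed.

Lemma path_metricC x y : delta x y = delta y x.
Proof. exact: distrC. Qed.

Lemma path_metric_triangle x y z : delta x z <= delta x y + delta y z.
Proof. exact: ler_distD. Qed.

Hypothesis contraction : forall t f M c, 0 < t -> bounded_by M f ->
  lipschitz_by delta c f -> lipschitz_by delta (expR (- (sigma * t)) * c) (Q t f).

Lemma stationary_ge0 x : 0 <= pi x.
Proof. by rewrite divr_ge0// ltW// ?(weight_gt0 rates) ?(mass_gt0 rates). Qed.

Lemma cvg_stationary : series pi n @[n --> \oo] --> (1 : R).
Proof.
have := cvg_mass rates erg; have := mass_gt0 rates erg.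
set Z := fine _ => Z0 cZ; rewrite -(divff (lt0r_neq0 Z0)).
have -> : series pi = (fun n => series mu n / Z).
  by apply/funext => n; rewrite /series /= mulr_suml.
by apply: cvgMl.
Qed.

Lemma series_stationary_le1 n : series pi n <= 1.
Proof.
rewrite -(cvg_lim (@Rhausdorff R) cvg_stationary).
apply: series_le_lim; first exact: stationary_ge0.
by apply/cvg_ex; eexists; exact: cvg_stationary.
Qed.

Lemma is_cvg_stationary_mean f M : bounded_by M f ->
  cvgn (series (fun z => f z * pi z)).
Proof.
move=> fM; rewrite (_ : (fun z => _) = (fun z => pi z * f z)); last first.
  by apply/funext => z; rewrite mulrC.
apply: (cvg_series_bounded_by fM); first exact: stationary_ge0.
by apply/cvg_ex; eexists; exact: cvg_stationary.
Qed.

Lemma stationary_invariant T f M : 0 < T -> bounded_by M f ->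
  series (fun z => (Q T f z - f z) * pi z) n @[n --> \oo] --> 0.
Proof.
move=> T0 fM; have := weight_invariant mQ gQ rates erg T0 fM.
move=> /(@cvgMr _ _ _ _ _ (fine (bd_mass lam nu))^-1); rewrite mulr0.
apply: cvg_trans; apply: near_eq_cvg; apply: nearW => n.
rewrite /series /= mulr_sumr; apply: eq_bigr => x _.
by rewrite /bd_stationary; ring.
Qed.

Lemma lipschitz_iter f M n : bounded_by M f -> lipschitz_by delta 1 f ->
  lipschitz_by delta (expR (- sigma) ^+ n) (iter n (Q 1) f).
Proof.
move=> fM f1; elim: n => [|n IH]; first by rewrite expr0.
have := contraction ltr01 (ms_iter_bounded mQ n ler01 fM) IH.
by rewrite mulr1 exprS.
Qed.

(** The semigroup laws concern bounded functions, so the distance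
to 0 is reached through its truncations. *)
Definition truncated_distance (r : R) x : R := Num.min (delta 0 x) r.

Lemma truncated_distance_bounded r : 0 <= r ->
  bounded_by r (truncated_distance r).
Proof.
move=> r0 x; rewrite ger0_norm ?ge_min ?lexx ?orbT//.
by rewrite le_min path_metric_ge0.
Qed.

Lemma truncated_distance_ge0 r x : 0 <= r -> 0 <= truncated_distance r x.
Proof. by move=> r0; rewrite le_min path_metric_ge0. Qed.

Lemma truncated_distance_lipschitz r : 0 <= r ->
  lipschitz_by delta 1 (truncated_distance r).
Proof.
move=> r0.
have H x y : truncated_distance r x - truncated_distance r y <= delta x y.
  rewrite lerBlDl [in leRHS]/truncated_distance addr_minl le_min; apply/andP; split.
    by rewrite ge_min [in delta x y]path_metricC path_metric_triangle.
  by rewrite ge_min lerDl path_metric_ge0 orbT.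
move=> x y; rewrite mul1r ler_norml H andbT lerNl opprB.
by rewrite path_metricC H.
Qed.

Hypothesis first_moment : exists A, forall r, 0 <= r ->
  Q 1 (truncated_distance r) 0%N <= A.

Let rho : R := expR (- sigma).

Let rho_gt0 : 0 < rho. Proof. exact: expR_gt0. Qed.

Let rho_lt1 : rho < 1. Proof. by rewrite /rho expR_lt1 oppr_lt0. Qed.

(** After n steps the function has slope at most rho^n, so the next step
raises its value at 0 by at most rho^n times a first moment; the increments sum to a
geometric series. *)
Lemma moment_iter : exists A, forall r n, 0 <= r ->
  iter n (Q 1) (truncated_distance r) 0%N <= A.
Proof.
have [A HA] := first_moment.
have A0 : 0 <= A.
  apply: le_trans (HA 0 (lexx _)).
  by have := ms_bounded mQ ler01 (truncated_distance_bounded (lexx 0)) 0%N; rewrite normr_le0 => /eqP ->.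
suff H r n : 0 <= r ->
    iter n (Q 1) (truncated_distance r) 0%N <= A * \sum_(k < n) rho ^+ k.
  exists (A / (1 - rho)) => r n r0; apply: le_trans (H r n r0) _.
  rewrite ler_wpM2l// -[leRHS]mul1r ler_pdivlMr ?subr_gt0//.
  have := subrX1 rho n; have : 0 <= rho ^+ n by rewrite exprn_ge0 ?ltW.
  lra.
move=> r0; elim: n => [|n IH].
  by rewrite big_ord0 mulr0 /= /truncated_distance path_metricxx ge_min lexx.
rewrite big_ord_recr/= mulrDr; set G := iter n (Q 1) (truncated_distance r).
have bf := truncated_distance_bounded r0.
have bG : bounded_by r G := ms_iter_bounded mQ n ler01 bf.
have G0 y : 0 <= G y.
  rewrite /G; elim: (n) y => [|m IHm] y; first exact: truncated_distance_ge0.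
  rewrite iterS -(ms_conservative mQ 0 y ler01).
  exact: (ms_mono mQ _ ler01 (bounded_by_cst 0) (ms_iter_bounded mQ m ler01 bf)).
have rn0 : 0 < rho ^+ n by rewrite exprn_gt0.
(* Truncating at r / rho ^+ n gives rho ^+ n * min (delta, r / rho ^+ n) =
   min (rho ^+ n * delta, r): both bounds on G at once. *)
have r'0 : 0 <= r / rho ^+ n by rewrite divr_ge0// ltW.
have bf' := truncated_distance_bounded r'0.
have GG y : G y <= G 0%N + rho ^+ n * truncated_distance (r / rho ^+ n) y.
  rewrite -lerBlDl /truncated_distance minr_pMr ?(ltW rn0)// le_min.
  have -> : rho ^+ n * (r / rho ^+ n) = r by rewrite mulrC divfK ?gt_eqF.
  apply/andP; split; last first.
    rewrite lerBlDr (le_trans (ler_norm _))// (le_trans (bG y))// lerDl.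
    exact: G0.
  have := lipschitz_iter n bf (truncated_distance_lipschitz r0) 0%N y.
  by rewrite -/G distrC; apply: le_trans; exact: ler_norm.
apply: (@le_trans _ _ (Q 1 (fun y => G 0%N + rho ^+ n * truncated_distance (r / rho ^+ n) y) 0%N)).
  apply: (ms_mono mQ _ ler01 bG _ GG).
  exact: (bounded_byD (bounded_by_cst _) (bounded_byZ _ bf')).
rewrite (ms_linear mQ _ _ ler01 (bounded_by_cst _) bf') (ms_conservative mQ)//.
by rewrite lerD// mulrC ler_wpM2r ?(ltW rn0)// HA.
Qed.

(** By invariance the mean of f = truncated_distance r is
that of Q_n f.  On a finite set Q_n f exceeds its value at 0, controlled by
[moment_iter], by an amount that contraction sends to 0; outside, Q_n f <= r meets
a small mass. *)
Lemma stationary_truncated_moment : exists A, forall r n, 0 <= r ->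
  series (fun z => truncated_distance r z * pi z) n <= A.
Proof.
have [A HA] := moment_iter; exists A => r m0 r0.
have bf := truncated_distance_bounded r0.
have A0 : 0 <= A.
  by apply: le_trans (HA 0 0%N (lexx _)); exact: truncated_distance_ge0.
pose pf := limn (series (fun z => truncated_distance r z * pi z)).
have pf0 z : 0 <= truncated_distance r z * pi z.
  by rewrite mulr_ge0 ?truncated_distance_ge0 ?stationary_ge0.
apply: (@le_trans _ _ pf).
  by apply: series_le_lim => //; exact: (is_cvg_stationary_mean bf).
apply/ler_addgt0Pr => e e0.
have [m Hm] : exists m, 1 - series pi m <= e / 2 / (r + 1).
  have ee : 0 < e / 2 / (r + 1) by rewrite !divr_gt0// ltr_wpDl.
  have /cvgrPdist_le /(_ _ ee) [m _ /(_ m (leqnn m))] := cvg_stationary.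
  by move=> H; exists m; apply: le_trans H; exact: ler_norm.
pose Dm := series (fun z => delta 0 z * pi z) m.
have Dm0 : 0 <= Dm.
  by rewrite /Dm /series /= sumr_ge0// => z _; rewrite mulr_ge0 ?path_metric_ge0 ?stationary_ge0.
have [n Hn] : exists n, rho ^+ n.+1 * Dm <= e / 2.
  have ee : 0 < e / 2 / (Dm + 1) by rewrite !divr_gt0// ltr_wpDl.
  have := @cvg_expr R rho; rewrite ger0_norm ?(ltW rho_gt0)// => /(_ rho_lt1).
  move=> /cvgrPdist_le /(_ _ ee) [n _ /(_ n.+1 (leqnSn n))].
  rewrite /= sub0r normrN ger0_norm ?exprn_ge0 ?(ltW rho_gt0)//.
  rewrite ler_pdivlMr ?ltr_wpDl// => H; exists n; apply: le_trans H.
  by rewrite ler_wpM2l ?exprn_ge0 ?(ltW rho_gt0)// lerDl.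
pose G := iter n.+1 (Q 1) (truncated_distance r).
have bG : bounded_by r G := ms_iter_bounded mQ n.+1 ler01 bf.
have GE : G = Q (n.+1%:R * 1) (truncated_distance r).
  by apply/funext => x; rewrite /G (ms_iter mQ _ _ ler01 bf).
have G_le y : G y <= A + rho ^+ n.+1 * delta 0 y.
  have := lipschitz_iter n.+1 bf (truncated_distance_lipschitz r0) y 0%N.
  rewrite -/G -/rho path_metricC => /(le_trans (ler_norm _)).
  have := HA r n.+1 r0; rewrite -/G; lra.
have cG : series (fun z => G z * pi z) k @[k --> \oo] --> pf.
  have nn : (0 : R) < n.+1%:R * 1 by rewrite mulr1 ltr0n.
  have := stationary_invariant nn bf; rewrite -GE => /cvgD.
  move=> /(_ _ _ (is_cvg_stationary_mean bf)); rewrite add0r -/pf.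
  apply: cvg_trans; apply: near_eq_cvg; apply: nearW => k.
  rewrite fctE /series /= -big_split; apply: eq_bigr => z _ /=.
  by rewrite mulrBl subrK.
rewrite -(cvg_lim (@Rhausdorff R) cG).
apply: limr_le; first by apply/cvg_ex; exists pf.
exists m => // k /= mk.
rewrite /series /= (@big_cat_nat _ _ _ m)//=.
have e2 : 0 < e / 2 by rewrite divr_gt0.
apply: (@le_trans _ _ (A * series pi m + rho ^+ n.+1 * Dm + r * (1 - series pi m))).
  apply: lerD.
    rewrite /Dm /series /= !mulr_sumr -big_split ler_sum// => z _ /=.
    by rewrite mulrA -mulrDl ler_wpM2r ?stationary_ge0.
  apply: (@le_trans _ _ (\sum_(m <= z < k) r * pi z)).
    apply: ler_sum => z _; rewrite ler_wpM2r ?stationary_ge0//.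
    by rewrite (le_trans (ler_norm _)).
  rewrite -mulr_sumr ler_wpM2l// lerBrDl.
  have := series_stationary_le1 k.
  by rewrite /series /= (@big_cat_nat _ _ _ m)//.
have A1 : A * series pi m <= A by rewrite ler_piMr// series_stationary_le1.
have : r * (1 - series pi m) <= e / 2.
  apply: (@le_trans _ _ ((r + 1) * (1 - series pi m))).
    by rewrite ler_wpM2r ?subr_ge0 ?series_stationary_le1// lerDl.
  by rewrite mulrC -ler_pdivlMr// ltr_wpDl.
lra.
Qed.

Lemma is_cvg_stationary_moment x : cvgn (series (fun z => delta x z * pi z)).
Proof.
have [A HA] := stationary_truncated_moment.
have D0 z : 0 <= delta 0 z * pi z by rewrite mulr_ge0 ?path_metric_ge0 ?stationary_ge0.
have c0 : cvgn (series (fun z => delta 0 z * pi z)).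
  apply: (@series_bounded_cvgn _ _ A) => // n.
  pose r := \sum_(z < n) delta 0 z.
  have r0 : 0 <= r by rewrite sumr_ge0// => i _; exact: path_metric_ge0.
  apply: le_trans (HA r n r0).
  rewrite /series /= !big_mkord ler_sum// => z _.
  rewrite ler_wpM2r ?stationary_ge0// le_min lexx /=.
  rewrite /r (bigD1 z)//= lerDl sumr_ge0// => i _; exact: path_metric_ge0.
apply: (@series_le_cvg _ _ (fun z => delta x 0 * pi z + delta 0 z * pi z)).
- by move=> z; rewrite mulr_ge0 ?path_metric_ge0 ?stationary_ge0.
- by move=> z; rewrite addr_ge0// mulr_ge0 ?path_metric_ge0 ?stationary_ge0.
- by move=> z; rewrite -mulrDl ler_wpM2r ?stationary_ge0// path_metric_triangle.
- have c1 : cvgn (series (fun z => delta x 0 * pi z)).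
    by apply: is_cvg_seriesZ; apply/cvg_ex; eexists; exact: cvg_stationary.
  rewrite (_ : series _ = series (fun z => delta x 0 * pi z) + series (fun z => delta 0 z * pi z)).
    exact: is_cvgD.
  by apply/funext => n; rewrite fctE /series /= -big_split.
Qed.

(** By invariance the difference is the mean over z, under pi, of
Q_t f x - Q_t f z, and each term is controlled by contraction. *)
Lemma semigroup_to_stationary t f M c x : 0 < t -> bounded_by M f ->
  lipschitz_by delta c f ->
  `|Q t f x - limn (series (fun z => f z * pi z))| <=
    expR (- (sigma * t)) * c * limn (series (fun z => delta x z * pi z)).
Proof.
move=> t0 fM fc; set pf := limn (series (fun z => f z * pi z)).
set D := limn _; set k := expR _ * c.
have c1 : series (fun z => (Q t f x - Q t f z) * pi z) n @[n --> \oo] --> Q t f x - pf.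
  have H1 : Q t f x * series pi n @[n --> \oo] --> Q t f x * 1.
    by apply: cvgMr; exact: cvg_stationary.
  have := cvgB H1 (cvgD (stationary_invariant t0 fM) (is_cvg_stationary_mean fM)).
  rewrite mulr1 add0r -/pf => /(_ _ _); apply: cvg_trans; apply: near_eq_cvg; apply: nearW => n.
  rewrite !fctE /series /= mulr_sumr -big_split -sumrB; apply: eq_bigr => z _ /=.
  by ring.
have c2 : k * series (fun z => delta x z * pi z) n @[n --> \oo] --> k * D.
  by apply: cvgMr; exact: is_cvg_stationary_moment.
apply: (ler_cvg_to (cvg_norm c1) c2); exists 0%N => // n _ /=.
rewrite /series /= mulr_sumr (le_trans (ler_norm_sum _ _ _))// ler_sum// => z _.
rewrite normrM (ger0_norm (stationary_ge0 _)) mulrA ler_wpM2r ?stationary_ge0//.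
exact: (contraction t0 fM fc).
Qed.

End curvature.
Arguments truncated_distance {R} u r x.

(** * The Markov property along a skeleton *)

Section filtration.
Context {R : realType} {d : measure_display} {Omega : measurableType d}.
Variable X : R -> {mfun Omega >-> nat}.
Implicit Types (A B : set Omega) (s t : R).

Lemma measurable_value t (d' : measure_display) (T : measurableType d')
    (f : nat -> T) D : measurable_fun D (fun w => f (X t w)).
Proof.
apply: measurable_funTS; apply: measurableT_comp => //.
Qed.

Lemma measurable_preimage t (B : set nat) : measurable (X t @^-1` B).
Proof. by rewrite -[_ @^-1` _]setTI; exact: measurable_funPT. Qed.

Lemma filtrationT s : natural_filtration X s setT.
Proof.
have [h0 hC _] := smallest_sigma_algebra (setT : set Omega)
  [set A | exists r (B : set nat), 0 <= r <= s /\ A = X r @^-1` B].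
by have := hC _ h0; rewrite setD0.
Qed.

Lemma filtrationI s A B : natural_filtration X s A ->
  natural_filtration X s B -> natural_filtration X s (A `&` B).
Proof.
have [h0 hC hU] := smallest_sigma_algebra (setT : set Omega)
  [set A | exists r (B : set nat), 0 <= r <= s /\ A = X r @^-1` B].
move=> fA fB; rewrite -[_ `&` _]setCK -setTD setCI; apply: (hC).
rewrite -bigcup2E; apply: hU => -[|[|n]]; rewrite /bigcup2 /=.
- by rewrite -setTD; exact: hC.
- by rewrite -setTD; exact: hC.
- exact: h0.
Qed.

Lemma filtration_preimage s t (B : set nat) : 0 <= s <= t ->
  natural_filtration X t (X s @^-1` B).
Proof. by move=> st; apply: sub_sigma_algebra; exists s, B. Qed.

Lemma filtration_le s t : s <= t ->
  natural_filtration X s `<=` natural_filtration X t.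
Proof.
move=> st; apply: sub_smallest2r; first exact: smallest_sigma_algebra.
move=> A [r [B [/andP[r0 rs] ->]]]; exists r, B; split=> //.
by rewrite r0 (le_trans rs).
Qed.

Lemma filtration_measurable s A : natural_filtration X s A -> measurable A.
Proof.
apply: smallest_sub; first exact: sigma_algebra_measurable.
by move=> B [r [C [_ ->]]]; exact: measurable_preimage.
Qed.

End filtration.

Section markov_property.
Context {R : realType} {d : measure_display} {Omega : measurableType d}.
Context {lam nu : nat -> R} {P : nat -> probability Omega R}.
Context {X : R -> {mfun Omega >-> nat}}.
Hypothesis bd : birth_death_process lam nu P X.
Implicit Types (A : set Omega) (s t h : R) (f : nat -> R) (x y : nat).

Lemma integral_split_values (m : {measure set Omega -> \bar R}) t A
    (g : Omega -> \bar R) : measurable A -> measurable_fun A g ->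
  (forall w, A w -> (0 <= g w)%E) ->
  (\int[m]_(w in A) g w =
   \sum_(y <oo) \int[m]_(w in A `&` X t @^-1` [set y]) g w)%E.
Proof.
move=> mA mg g0.
have AE : A = \bigcup_y (A `&` X t @^-1` [set y]).
  by rewrite -setI_bigcupr -preimage_bigcup bigcup_imset1 image_id preimage_setT setIT.
rewrite {1}AE ge0_integral_bigcup -?AE// => [y|].
- by apply: measurableI => //; exact: measurable_preimage.
- move=> i j _ _ [w [[_ /= <-] [_ /= <-]]] //.
Qed.

Lemma integral_value (m : {measure set Omega -> \bar R}) t A
    (g : nat -> \bar R) : measurable A -> (forall y, 0 <= g y)%E ->
  (\int[m]_(w in A) g (X t w) =
   \sum_(y <oo) g y * m (A `&` X t @^-1` [set y]))%E.
Proof.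
move=> mA g0; rewrite (integral_split_values _ t)//; last exact: (measurable_value X t g).
apply: eq_eseriesr => y _.
rewrite (eq_integral (cst (g y))) ?integral_cst//.
  by apply: measurableI => //; exact: measurable_preimage.
by move=> w; rewrite inE => -[_ /= ->].
Qed.

Definition expected (t : R) (g : nat -> \bar R) (x : nat) : \bar R :=
  (\int[P x]_w g (X t w))%E.

(** The Markov property of the process concerns the events
X_(s+t) = y; this is its extension to functions, by summation over y. *)
Lemma markov_integral x s t A (g : nat -> \bar R) : 0 <= s -> 0 <= t ->
  natural_filtration X s A -> (forall y, 0 <= g y)%E ->
  (\int[P x]_(w in A) g (X (s + t) w) =
   \int[P x]_(w in A) expected t g (X s w))%E.
Proof.
move=> s0 t0 fA g0; have mA := filtration_measurable fA.
rewrite integral_value//.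
rewrite (eq_integral (fun w => \sum_(y <oo) g y * P (X s w) (X t @^-1` [set y])))%E; last first.
  move=> w _; rewrite /expected integral_value//.
  by apply: eq_eseriesr => y _; rewrite setTI.
rewrite integral_nneseries//; last 2 first.
- move=> y; exact: (measurable_value X s (fun z => g y * P z (X t @^-1` [set y])))%E.
- by move=> y w _; rewrite mule_ge0.
apply: eq_eseriesr => y _; rewrite ge0_integralZl//.
- by congr (_ * _)%E; exact: (bd_markov bd x y s0 t0 fA).
- exact: (measurable_value X s (fun z => P z (X t @^-1` [set y]))).
Qed.

Lemma integral_start x (g : nat -> \bar R) : (forall y, 0 <= g y)%E ->
  (\int[P x]_w g (X 0 w) = g x)%E.
Proof.
move=> g0; have P0 := bd_start bd x.
have mx : measurable (X 0 @^-1` [set x]) by exact: measurable_preimage.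
rewrite (@ge0_negligible_integral _ _ _ _ setT (~` (X 0 @^-1` [set x])))//.
- rewrite setTD setCK (eq_integral (cst (g x))); last first.
    by move=> w; rewrite inE => /= ->.
  by rewrite integral_cst// -[RHS]mule1; congr (_ * _)%E; exact: P0.
- exact: measurableC.
- exact: (measurable_value X 0 g).
- apply: (etrans (probability_setC (P x) mx)).
  by rewrite (_ : _ (_ @^-1` _) = 1%E)// subee.
Qed.

Lemma semigroupE t f x :
  semigroup P X t f x = (\int[P x]_w f (X t w))%R.
Proof. by rewrite /semigroup unlock. Qed.

Lemma integrable_value t f M x : bounded_by M f ->
  (P x).-integrable setT (EFin \o (fun w => f (X t w))).
Proof.
move=> fM; apply: measurable_bounded_integrable => //.
- by rewrite (le_lt_trans (probability_le1 _ _))// ltry.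
- exact: (measurable_value X t f).
- exists M; split; first exact: num_real.
  by move=> z Mz w _ /=; rewrite (le_trans (fM _))// ltW.
Qed.

Lemma semigroup_expected t f M x : bounded_by M f ->
  expected t (EFin \o f) x = (semigroup P X t f x)%:E.
Proof.
move=> fM; rewrite semigroupE /Rintegral fineK//.
exact: (integrable_fin_num _ (integrable_value _ _ fM)).
Qed.

Lemma semigroup_linear t f g M N a x : bounded_by M f -> bounded_by N g ->
  semigroup P X t (fun y => f y + a * g y) x =
  semigroup P X t f x + a * semigroup P X t g x.
Proof.
move=> fM gN; rewrite !semigroupE RintegralD//; last 2 first.
- exact: integrable_value fM.
- exact: (integrable_value (f := fun y => a * g y) _ _ (bounded_byZ a gN)).
by rewrite RintegralZl//; exact: integrable_value gN.
Qed.

Lemma semigroup_cst t (c : R) x : semigroup P X t (fun=> c) x = c.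
Proof.
rewrite semigroupE Rintegral_cst// -[RHS]mulr1; congr (_ * _).
by rewrite -[RHS]/(fine 1%E); congr fine; exact: (probability_setT (P x)).
Qed.

Lemma semigroup_mono t f g M N x : bounded_by M f -> bounded_by N g ->
  (forall y, f y <= g y) -> semigroup P X t f x <= semigroup P X t g x.
Proof.
move=> fM gN fg; rewrite !semigroupE; apply: le_Rintegral => //.
- exact: integrable_value fM.
- exact: integrable_value gN.
Qed.

Lemma semigroup_bounded t f M : bounded_by M f ->
  bounded_by M (semigroup P X t f).
Proof.
move=> fM x; rewrite ler_norml; apply/andP; split.
  rewrite -(semigroup_cst t (- M) x).
  apply: (semigroup_mono _ _ (bounded_by_cst _) fM) => y.
  by have := fM y; rewrite ler_norml => /andP[].
rewrite -[leRHS](semigroup_cst t M x).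
apply: (semigroup_mono _ _ fM (bounded_by_cst _)) => y.
by have := fM y; rewrite ler_norml => /andP[].
Qed.

Lemma semigroup_add s t f M x : 0 <= s -> 0 <= t -> bounded_by M f ->
  semigroup P X (s + t) f x = semigroup P X s (semigroup P X t f) x.
Proof.
move=> s0 t0 fM; have M0 := bounded_by_ge0 fM.
pose g y := f y + M.
have gM : bounded_by (M + `|M|) g := bounded_byD fM (bounded_by_cst M).
have g0 y : 0 <= g y.
  by have := fM y; rewrite ler_norml /g => /andP[]; rewrite -subr_ge0 opprK addrC.
have gadd : semigroup P X (s + t) g x = semigroup P X s (semigroup P X t g) x.
  apply: EFin_inj; rewrite -(semigroup_expected _ _ gM).
  rewrite -(semigroup_expected _ _ (semigroup_bounded t gM)).
  rewrite /expected markov_integral//; last exact: filtrationT.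
  by apply: eq_integral => w _; exact: (semigroup_expected _ _ gM).
have gE r z : semigroup P X r g z = semigroup P X r f z + M.
  have -> : g = (fun y => f y + 1 * M) by apply/funext => y; rewrite mul1r.
  by rewrite (semigroup_linear _ _ _ fM (bounded_by_cst M)) semigroup_cst mul1r.
have := gadd; rewrite gE.
have -> : semigroup P X t g = (fun y => semigroup P X t f y + 1 * M).
  by apply/funext => y; rewrite gE mul1r.
rewrite (semigroup_linear _ _ _ (semigroup_bounded t fM) (bounded_by_cst M)).
by rewrite semigroup_cst mul1r => /addIr.
Qed.

Lemma semigroup_markov : markov_semigroup (semigroup P X).
Proof.
split=> [t f g M N a x _ fM gN|t f g M N x _ fM gN fg|t c x _|s t f M x s0 t0 fM].
- exact: semigroup_linear fM gN.
- exact: semigroup_mono fM gN fg.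
- exact: semigroup_cst.
- exact: semigroup_add fM.
Qed.

(** By induction on n, splitting A along the value of X_(s+h): the
pieces belong to the filtration at time s + h, which is why s and A are arbitrary. *)
Lemma skeleton_integral x s h (a : nat -> R) M n A : 0 <= s -> 0 <= h ->
  bounded_by M a -> (forall y, 0 <= a y) -> natural_filtration X s A ->
  (\int[P x]_(w in A) (\prod_(k < n) a (X (s + k.+1%:R * h)%R w))%:E =
   \int[P x]_(w in A) (skeleton (semigroup P X) h a n (X s w))%:E)%E.
Proof.
move=> + h0 aM a0; elim: n s A => [|n IH] s A s0 fA.
  by apply: eq_integral => w _; rewrite big_ord0.
have sh0 : 0 <= s + h by rewrite addr_ge0.
have mA := filtration_measurable fA.
have [N bN] := skeleton_bounded semigroup_markov n h0 aM.
have bV : bounded_by (M * N) (fun y => a y * skeleton (semigroup P X) h a n y).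
  by move=> y; rewrite normrM ler_pM.
transitivity (\int[P x]_(w in A) ((EFin \o (fun y => a y * skeleton (semigroup P X) h a n y)%R) (X (s + h)%R w)))%E.
  have mm m' r D : measurable_fun D (fun w => (\prod_(k < m') a (X (r + k.+1%:R * h) w))%:E).
    apply/measurable_EFinP; apply: measurable_prod => k _.
    exact: (measurable_value X _ a).
  have pr0 m' r w : 0 <= \prod_(k < m') a (X (r + k.+1%:R * h) w).
    by apply: prodr_ge0 => k _.
  rewrite (integral_split_values _ (s + h))//; last by move=> w _; exact: pr0.
  rewrite [RHS](integral_split_values _ (s + h))//; last 2 first.
  - exact: (measurable_value X _ (EFin \o (fun y => a y * skeleton (semigroup P X) h a n y))).
  - by move=> w _; rewrite /= lee_fin mulr_ge0// (skeleton_ge0 semigroup_markov _ _ h0 aM a0).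
  apply: eq_eseriesr => y _; set D := A `&` _.
  have fD : natural_filtration X (s + h) D.
    apply: filtrationI; first by apply: (filtration_le (s := s)) => //; rewrite lerDl.
    by apply: filtration_preimage; rewrite sh0 lexx.
  have mD := filtration_measurable fD.
  transitivity ((a y)%:E * \int[P x]_(w in D) (\prod_(k < n) a (X (s + h + k.+1%:R * h)%R w))%:E)%E.
    rewrite -ge0_integralZl//; [|by move=> w _; exact: pr0|exact: a0].
    apply: eq_integral => w; rewrite inE => -[_ /= Xy].
    rewrite big_ord_recl /= mul1r Xy EFinM; congr (_ * (_)%:E)%E.
    apply: eq_bigr => k _; congr (a (X _ w)).
    by rewrite /bump /= add1n [in LHS]mulrS mulrDl mul1r addrA.
  rewrite IH// -ge0_integralZl//; last 3 first.
  - exact: (measurable_value X _ (fun z => (skeleton (semigroup P X) h a n z)%:E)).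
  - by move=> w _; rewrite /= lee_fin (skeleton_ge0 semigroup_markov _ _ h0 aM).
  - by rewrite lee_fin.
  by apply: eq_integral => w; rewrite inE => -[_ /= ->]; rewrite EFinM.
rewrite markov_integral//; last first.
  by move=> y; rewrite /= lee_fin mulr_ge0// (skeleton_ge0 semigroup_markov _ _ h0 aM).
by apply: eq_integral => w _; rewrite (semigroup_expected _ _ bV).
Qed.

Lemma skeleton_expectation x h (a : nat -> R) M n : 0 <= h ->
  bounded_by M a -> (forall y, 0 <= a y) ->
  (\int[P x]_w (\prod_(k < n) a (X (k.+1%:R * h)%R w))%:E =
   (skeleton (semigroup P X) h a n x)%:E)%E.
Proof.
move=> h0 aM a0.
have := skeleton_integral x n (lexx 0) h0 aM a0 (@filtrationT _ _ _ X 0).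
under eq_integral do under eq_bigr do rewrite add0r.
move=> ->; apply: (@integral_start x (EFin \o skeleton (semigroup P X) h a n)) => y.
by rewrite lee_fin (skeleton_ge0 semigroup_markov _ _ h0 aM).
Qed.

End markov_property.

(** * Contraction and first moment from the curvature *)

Section lipschitz_norm.
Context {R : realType} {u : nat -> R}.
Hypothesis u0 : forall x, 0 < u x.
Implicit Types (f g : nat -> R) (c : R) (x y : nat).

Local Notation delta := (path_metric u).

Lemma path_metric_add x k :
  delta x (x + k)%N = \sum_(x <= i < (x + k)%N) u i.
Proof.
rewrite /path_metric -!(big_mkord xpredT u) distrC.
rewrite (@big_cat_nat _ _ _ x 0 (x + k)%N)//= ?leq_addr// addrAC subrr add0r ger0_norm//.
by rewrite sumr_ge0// => i _; exact: ltW.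
Qed.

Lemma path_metric_gt0 x y : x != y -> 0 < delta x y.
Proof.
wlog xy : x y / (x < y)%N.
  by rewrite neq_ltn => H /orP[xy|yx]; [|rewrite path_metricC]; apply: H; rewrite // ltn_eqF.
move=> _; rewrite -(subnKC xy) addSnnS path_metric_add addnS big_nat_recl ?leq_addr//.
by rewrite ltr_pwDl// sumr_ge0// => i _; exact: ltW.
Qed.

Lemma path_metricS x : delta x x.+1 = u x.
Proof. by rewrite -addn1 path_metric_add addn1 big_nat1. Qed.

Lemma lip_norm_le f c : (lip_norm delta f <= c%:E)%E <-> lipschitz_by delta c f.
Proof.
split=> [fc x y|fc].
  have [->|xy] := eqVneq x y; first by rewrite subrr normr0 path_metricxx mulr0.
  rewrite -ler_pdivrMr ?path_metric_gt0// -lee_fin; apply: le_trans fc.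
  by apply: ereal_sup_ubound; exists x, y.
apply: ge_ereal_sup => _ [x [y [xy ->]]].
by rewrite lee_fin ler_pdivrMr ?path_metric_gt0.
Qed.

Lemma lip_norm_ge0 f : (0 <= lip_norm delta f)%E.
Proof.
apply: (@le_trans _ _ (`|f 0%N - f 1%N| / delta 0 1)%:E).
  by rewrite lee_fin divr_ge0 ?path_metric_ge0.
by apply: ereal_sup_ubound; exists 0%N, 1%N.
Qed.

Lemma lip_norm_fine f : (lip_norm delta f < +oo)%E ->
  lipschitz_by delta (fine (lip_norm delta f)) f.
Proof. by move=> fy; apply/lip_norm_le; rewrite fineK// ge0_fin_numE ?lip_norm_ge0. Qed.

Lemma lipschitz_ge0 f c : lipschitz_by delta c f -> 0 <= c.
Proof.
move=> /(_ 0%N 1%N) H; rewrite -(pmulr_lge0 _ (path_metric_gt0 (isT : 0 != 1)%N)).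
exact: le_trans H.
Qed.

Lemma lipschitz0 f : lipschitz_by delta 0 f -> f = (fun=> f 0%N).
Proof.
move=> H; apply/funext => x; apply/eqP.
by rewrite -subr_eq0 -normr_le0 (le_trans (H _ _))// mul0r.
Qed.

(** The Wasserstein rate is a supremum over functions of Lipschitz
norm exactly 1, so that is what has to be reached. *)
Lemma lip_norm_normalize f : (lip_norm delta f < +oo)%E ->
  0 < fine (lip_norm delta f) ->
  lip_norm delta (fun x => (fine (lip_norm delta f))^-1 * f x) = 1%E.
Proof.
move=> fy; set N := fine _ => N0; set g := fun x => _.
have NE : lip_norm delta f = N%:E by rewrite /N fineK// ge0_fin_numE ?lip_norm_ge0.
have g1 : (lip_norm delta g <= 1%:E)%E.
  apply/lip_norm_le => x y; rewrite /g -mulrBr normrM gtr0_norm ?invr_gt0//.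
  by rewrite ler_pdivrMl// mul1r lip_norm_fine.
have gy : (lip_norm delta g < +oo)%E by rewrite (le_lt_trans g1)// ltry.
have gfin : lip_norm delta g \is a fin_num by rewrite ge0_fin_numE ?lip_norm_ge0.
apply/eqP; rewrite eq_le g1 /= -(fineK gfin) lee_fin.
have /lip_norm_le : lipschitz_by delta (N * fine (lip_norm delta g)) f.
  move=> x y; have := lip_norm_fine gy x y.
  by rewrite /g -mulrBr normrM gtr0_norm ?invr_gt0// ler_pdivrMl// mulrA.
by rewrite NE lee_fin ler_pMr.
Qed.

End lipschitz_norm.

Section contraction.
Context {R : realType} {d : measure_display} {Omega : measurableType d}.
Context {lam nu u : nat -> R} {P : nat -> probability Omega R}.
Context {X : R -> {mfun Omega >-> nat}} {sigma : R}.
Hypothesis bd : birth_death_process lam nu P X.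
Hypothesis u0 : forall x, 0 < u x.
Hypothesis sigma0 : 0 < sigma.

Local Notation delta := (path_metric u).
Local Notation Q := (semigroup P X).

Hypothesis curv : wasserstein_curvature delta P X = sigma%:E.

Let mQ : markov_semigroup Q := semigroup_markov bd.

(** The limit defining the curvature exists, for otherwise its
value would be the default 0; so the rate exceeds s t for all small t. *)
Lemma short_time_contraction s : s < sigma -> exists2 t0, 0 < t0 &
  forall t f M c, 0 < t < t0 -> bounded_by M f -> lipschitz_by delta c f ->
    lipschitz_by delta (expR (- (s * t)) * c) (Q t f).
Proof.
move=> ssig.
have cv : (wasserstein_rate delta P X t * (t^-1)%:E)%E @[t --> (0 : R)^'+] --> sigma%:E.
  move: curv; rewrite /wasserstein_curvature => E; rewrite -E.
  apply: contrapT => /dvgP; rewrite E => /(congr1 fine) /= sp.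
  by move: sigma0; rewrite sp ltxx.
have : \forall t \near (0 : R)^'+,
    (s%:E < wasserstein_rate delta P X t * (t^-1)%:E)%E.
  have ssE : (s%:E < sigma%:E)%E by rewrite lte_fin.
  exact: (cv _ (open_ereal_gt' ssE)).
rewrite near_withinE => -[t0 /= t00 H]; exists t0 => // t f M c /andP[tpos tt0] fM fc.
have := H t; rewrite /= sub0r normrN gtr0_norm// => /(_ tt0 tpos).
rewrite lte_pdivlMr// => Hs.
have Hsup g : lip_norm delta g = 1%E -> (lip_norm delta (Q t g) <= (expR (- (s * t)))%:E)%E.
  move=> g1; have : (lne (lip_norm delta (Q t g)) <= (- (s * t))%:E)%E.
    apply: (@le_trans _ _ (- wasserstein_rate delta P X t)%E).
      by rewrite /wasserstein_rate oppeK; apply: ereal_sup_ubound; exists g.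
    by rewrite EFinN leeN2 EFinM ltW.
  rewrite -lee_expeR lneK//.
  by rewrite in_itv /= lip_norm_ge0 leey.
have fy : (lip_norm delta f < +oo)%E.
  by apply: le_lt_trans (ltry c); apply/lip_norm_le.
have [N0|N0] := eqVneq (fine (lip_norm delta f)) 0.
  have := lip_norm_fine u0 fy; rewrite N0 => /lipschitz0 ->.
  move=> x y; rewrite !(ms_conservative mQ) ?(ltW tpos)// subrr normr0.
  by rewrite !mulr_ge0 ?expR_ge0 ?path_metric_ge0// (lipschitz_ge0 u0 fc).
have Npos : 0 < fine (lip_norm delta f) by rewrite lt0r N0 fine_ge0 ?lip_norm_ge0.
set N := fine _ in N0 Npos.
have Nc : N <= c.
  by rewrite -lee_fin /N fineK ?ge0_fin_numE ?lip_norm_ge0//; apply/lip_norm_le.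
have /Hsup/lip_norm_le Hg := lip_norm_normalize u0 fy Npos.
move=> x y; have := Hg u0 x y; rewrite !(msZ mQ _ _ (ltW tpos) fM).
rewrite -mulrBr normrM gtr0_norm ?invr_gt0// ler_pdivrMl// => /le_trans; apply.
rewrite mulrA ler_wpM2r ?path_metric_ge0// mulrC ler_wpM2l ?expR_ge0//.
Qed.

(** Over n steps of length t / n the constants exp (- s t / n)
multiply to exp (- s t); then s tends to sigma. *)
Lemma curvature_contraction t f M c : 0 < t -> bounded_by M f ->
  lipschitz_by delta c f ->
  lipschitz_by delta (expR (- (sigma * t)) * c) (Q t f).
Proof.
move=> t0 fM fc.
have key s : s < sigma -> lipschitz_by delta (expR (- (s * t)) * c) (Q t f).
  move=> /short_time_contraction [h0 h00 H].
  have [n /(_ _ (leqnn n)) hh] := step_lt t0 h00.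
  set h := t / n.+1%:R in hh; have hpos : 0 < h by case/andP: hh.
  have nh : n.+1%:R * h = t by rewrite mulrC divfK// pnatr_eq0.
  clearbody h.
  have : lipschitz_by delta (expR (- (s * h)) ^+ n.+1 * c) (iter n.+1 (Q h) f).
    elim: n.+1 => [|k IH]; first by rewrite expr0 mul1r.
    rewrite exprS -mulrA; apply: (H _ _ _ _ hh _ IH).
    exact: (ms_iter_bounded mQ k (ltW hpos) fM).
  rewrite -expRM_natl mulrN mulrCA nh => Hi x y.
  by have := Hi x y; rewrite !(ms_iter mQ _ _ (ltW hpos) fM) nh.
move=> x y.
have c1 : expR (- ((sigma - n.+1%:R^-1) * t)) * c * delta x y @[n --> \oo] -->
    expR (- (sigma * t)) * c * delta x y.
  apply: cvgMl; apply: cvgMl; apply: continuous_cvg; first exact: continuous_expR.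
  apply: cvgN; apply: cvgMl; rewrite -[X in _ --> X]subr0.
  by apply: cvgB; [exact: cvg_cst|exact: cvg_harmonic].
apply: (ler_cvg_to (cvg_cst _) c1); exists 0%N => // n _ /=.
by apply: key; rewrite ltrBlDr ltrDl invr_gt0 ltr0n.
Qed.

Hypothesis moments : forall (t : R) (x : nat), 0 < t ->
  wasserstein_space delta (distribution (P x) (X t)).

(** The triangle inequality moves the base point of the moment
assumption to 0. *)
Lemma first_moment_bound : exists A, forall r, 0 <= r ->
  Q 1 (truncated_distance u r) 0%N <= A.
Proof.
have [x Hx] := moments 0 ltr01.
pose m := (\sum_(y <oo) (delta x y)%:E * distribution (P 0) (X 1) [set y])%E.
have m0 : (0 <= m)%E.
  by apply: nneseries_ge0 => y _ _; rewrite mule_ge0// lee_fin path_metric_ge0.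
exists (delta 0 x + fine m) => r r0.
have bf := truncated_distance_bounded (u := u) r0.
have dx0 y : (0 <= (delta x y)%:E)%E by rewrite lee_fin path_metric_ge0.
have mE : m = (\int[P 0]_w (delta x (X 1 w))%:E)%E.
  rewrite (integral_value (X := X) (P 0) 1 (g := fun y => (delta x y)%:E))//.
  by apply: eq_eseriesr => y _; rewrite setTI.
have mfin : m \is a fin_num by rewrite ge0_fin_numE.
rewrite -lee_fin EFinD (fineK mfin) mE -(semigroup_expected _ _ bf) /expected.
apply: (@le_trans _ _ (\int[P 0]_w ((delta 0 x)%:E + (delta x (X 1 w))%:E))%E).
  apply: ge0_le_integral => //.
  - by move=> w _; rewrite /= lee_fin truncated_distance_ge0.
  - exact: (measurable_value X 1 (EFin \o truncated_distance u r)).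
  - exact: (measurable_value X 1 (fun y => (delta 0 x)%:E + (delta x y)%:E)%E).
  - move=> w _; rewrite /= -EFinD lee_fin (le_trans _ (path_metric_triangle 0 x _))//.
    by rewrite ge_min lexx.
rewrite ge0_integralD//; last 2 first.
- by move=> w _; rewrite lee_fin path_metric_ge0.
- exact: (measurable_value X 1 (fun y => (delta x y)%:E)).
rewrite integral_cst// leeD2r// -[leRHS]mule1 lee_pmul// ?lee_fin ?path_metric_ge0//.
exact: probability_le1.
Qed.

End contraction.

(** * Exponential moments along a skeleton *)

Section exponential_moments.
Context {R : realType} {lam nu u : nat -> R}.
Context {Q : R -> (nat -> R) -> nat -> R} {sigma K C : R}.
Hypothesis mQ : markov_semigroup Q.
Hypothesis gQ : forall (f : nat -> R) x, bounded_fun f ->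
  (Q t f x - f x) / t @[t --> (0 : R)^'+] --> bd_generator lam nu f x.
Hypothesis rates : birth_death_rates lam nu.
Hypothesis sigma0 : 0 < sigma.
Hypothesis K0 : 0 < K.
Hypothesis C0 : 0 < C.
Hypothesis u0 : forall x, 0 < u x.
Hypothesis lamu : forall x, lam x * u x ^+ 2 <= C ^+ 2.
Hypothesis nuu : forall x, nu x.+1 * u x ^+ 2 <= C ^+ 2.
Hypothesis Ku : forall x, K * u x ^+ 2 <= C ^+ 2.
Implicit Types (f g F phi : nat -> R) (M t h c tau : R) (x y n m : nat).

Local Notation L := (bd_generator lam nu).
Local Notation delta := (path_metric u).

Hypothesis contraction : forall t f M c, 0 < t -> bounded_by M f ->
  lipschitz_by delta c f -> lipschitz_by delta (expR (- (sigma * t)) * c) (Q t f).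

Definition expR_remainder (z : R) : R := expR z - 1 - z.

(** A c-Lipschitz function changes by at most c * u_x <= c * C / sqrt K
along a jump. *)
Definition jump_size (c : R) : R := c * C / Num.sqrt K.

Lemma sqr_jump_size tau c : (tau * jump_size c) ^+ 2 = (tau * c) ^+ 2 * (C ^+ 2 / K).
Proof.
rewrite /jump_size !exprMn exprVn sqr_sqrtr ?(ltW K0)//.
by ring.
Qed.

(** For a jump of length v at rate r, [expR_remainder_le] replaces the
remainder by (tau c v)^2 / (tau c C / sqrt K)^2 times the remainder at the largest
jump, and r v^2 <= C^2 leaves the factor K. *)
Lemma rate_remainder_le (r v c tau z : R) : 0 < tau -> 0 < c -> 0 <= v ->
  0 <= r -> r * v ^+ 2 <= C ^+ 2 -> K * v ^+ 2 <= C ^+ 2 ->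
  `|z| <= tau * (c * v) ->
  r * expR_remainder z <= K * expR_remainder (tau * jump_size c).
Proof.
move=> tau0 c0 v0 r0 rv Kv zv.
have a0 : 0 < tau * jump_size c.
  by rewrite mulr_gt0// divr_gt0 ?mulr_gt0// sqrtr_gt0.
have za : `|z| <= tau * jump_size c.
  apply: (le_trans zv); rewrite ler_pM2l// /jump_size -mulrA ler_pM2l//.
  rewrite ler_pdivlMr ?sqrtr_gt0// -(@ler_pXn2r _ 2) ?nnegrE ?mulr_ge0 ?sqrtr_ge0 ?(ltW C0)//.
  by rewrite exprMn sqr_sqrtr ?(ltW K0)// mulrC.
have := expR_remainder_le za; rewrite -/(expR_remainder z) -/(expR_remainder _).
set A := expR_remainder (_ * _) => H.
have A0 : 0 <= A by rewrite /A /expR_remainder -addrA -opprD subr_ge0 expR_ge1Dx.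
have z2 : z ^+ 2 <= (tau * c) ^+ 2 * v ^+ 2.
  by rewrite -exprMn -mulrA -real_normK ?num_real// lerXn2r ?nnegrE ?mulr_ge0// ltW.
have tc0 : 0 < (tau * c) ^+ 2 by rewrite exprn_gt0// mulr_gt0.
have C20 : 0 < C ^+ 2 / K by rewrite divr_gt0// exprn_gt0.
have : (tau * c) ^+ 2 * (C ^+ 2 / K) * expR_remainder z <= (tau * c) ^+ 2 * (v ^+ 2 * A).
  rewrite -sqr_jump_size; apply: le_trans H _.
  by rewrite mulrA ler_wpM2r.
rewrite -mulrA ler_pM2l// => H1.
rewrite -(ler_pM2l C20) mulrCA.
apply: (@le_trans _ _ (r * (v ^+ 2 * A))); first by rewrite ler_wpM2l.
by rewrite (mulrA r) (mulrA (C ^+ 2 / K)) divfK ?gt_eqF// ler_wpM2r.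
Qed.

(** The two jumps from x, up and down, each contribute at most
K * expR_remainder (tau * jump_size c). *)
Lemma generator_exp_le F c tau x : 0 < tau -> 0 < c ->
  lipschitz_by delta c F ->
  L (fun y => expR (tau * (F y - F x))) x <=
    tau * L F x + 2 * K * expR_remainder (tau * jump_size c).
Proof.
move=> tau0 c0 Fc; set B := expR_remainder (_ * jump_size c).
have b1 : lam x * expR_remainder (tau * (F x.+1 - F x)) <= K * B.
  apply: (rate_remainder_le (v := u x)) => //.
  - exact/ltW.
  - exact/ltW/(bd_birth_gt0 rates).
  - rewrite normrM gtr0_norm// ler_pM2l// (le_trans (Fc _ _))//.
    by rewrite path_metricC path_metricS.
have b2 : nu x * expR_remainder (tau * (F x.-1 - F x)) <= K * B.
  case: x {b1} => [|x] /=.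
    rewrite (bd_death0 rates) mul0r mulr_ge0// ?(ltW K0)// /B /expR_remainder.
    by rewrite -addrA -opprD subr_ge0 expR_ge1Dx.
  apply: (rate_remainder_le (v := u x)) => //.
  - exact/ltW.
  - exact/ltW/(bd_death_gt0 rates).
  - rewrite normrM gtr0_norm// ler_pM2l// (le_trans (Fc _ _))//.
    by rewrite path_metricS.
rewrite /bd_generator !subrr mulr0 expR0.
by move: b1 b2; rewrite /expR_remainder; lra.
Qed.

(** Expand both sides to first order in h; the exponent on the right uses
1 + a <= exp a.  Boundedness of F makes the errors uniform in F, but h0 depends on x
because the rates may be unbounded. *)
Lemma one_step M c tau (e : R) x : 0 <= M -> 0 < c -> 0 < tau -> 0 < e ->
  exists2 h0, 0 < h0 & forall h F, 0 < h < h0 -> bounded_by M F ->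
    lipschitz_by delta c F ->
    Q h (fun y => expR (tau * F y)) x <=
      expR (tau * Q h F x +
            h * (2 * K * expR_remainder (tau * jump_size c) + e)).
Proof.
move=> M0 c0 tau0 e0; set B := expR_remainder _.
(* E bounds exp (tau * (F y - F x)), to which the generator is applied. *)
pose E := expR (tau * (M + M)).
have E0 : 0 < E by exact: expR_gt0.
have EM : 0 < E + tau * M by rewrite ltr_pwDl// mulr_ge0// ltW.
have [h0 h00 H] := generator_uniform mQ gQ x (divr_gt0 e0 EM).
exists h0 => // h F hh FM Fc; have h_gt0 : 0 < h by case/andP: hh.
pose g y := expR (tau * (F y - F x)).
have bg : bounded_by E g.
  move=> y; rewrite gtr0_norm ?expR_gt0// ler_expR ler_pM2l//.
  by rewrite (le_trans (ler_norm _))// (le_trans (ler_normB _ _))// lerD.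
have -> : Q h (fun y => expR (tau * F y)) x = expR (tau * F x) * Q h g x.
  rewrite -(msZ mQ _ _ (ltW h_gt0) bg); congr (Q _ _ _); apply/funext => y.
  by rewrite /g -expRD -mulrDr addrC subrK.
have Hg := H _ _ _ hh bg; have HF := H _ _ _ hh FM.
have gx : g x = 1 by rewrite /g subrr mulr0 expR0.
have Lg := generator_exp_le x tau0 c0 Fc; rewrite -/g -/B in Lg.
set k := e / (E + tau * M) in Hg HF.
have kE : k * (E + tau * M) = e by rewrite /k divfK// gt_eqF.
apply: (@le_trans _ _ (expR (tau * F x) * expR (h * L g x + k * h * E))).
  rewrite ler_wpM2l ?expR_ge0//; apply: le_trans (expR_ge1Dx _).
  by move: Hg; rewrite gx ler_norml => /andP[_]; lra.
rewrite -expRD ler_expR.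
have : tau * (Q h F x - F x - h * L F x) >= - (tau * (k * h * M)).
  by rewrite -mulrN ler_pM2l//; move: HF; rewrite ler_norml => /andP[].
have : h * L g x <= h * (tau * L F x + 2 * K * B) by rewrite ler_pM2l.
have -> : h * (2 * K * B + e) = h * (2 * K * B) + h * (k * (E + tau * M)).
  by rewrite kE mulrDr.
lra.
Qed.

(** When Q is the semigroup of X, the expectation under P y of
h * (phi (X_h) + ... + phi (X_(mh))). *)
Definition potential h phi m : nat -> R :=
  fun y => h * \sum_(k < m) iter k.+1 (Q h) phi y.

Lemma potential_bounded h phi M m : 0 <= h -> bounded_by M phi ->
  bounded_by (m%:R * h * M) (potential h phi m).
Proof.
move=> h0 bphi y; rewrite normrM ger0_norm//.
rewrite [leRHS](_ : _ = h * (m%:R * M)); last by ring.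
rewrite ler_wpM2l//.
rewrite (le_trans (ler_norm_sum _ _ _))//.
rewrite (le_trans (ler_sum _ (fun (k : 'I_m) _ => ms_iter_bounded mQ k.+1 h0 bphi y)))//.
by rewrite sumr_const card_ord mulr_natl.
Qed.

Lemma potentialS h phi M m x : 0 <= h -> bounded_by M phi ->
  Q h (fun y => h * phi y + potential h phi m y) x = potential h phi m.+1 x.
Proof.
move=> h0 bphi.
rewrite (msD mQ x h0 (bounded_byZ h bphi) (potential_bounded m h0 bphi)).
rewrite (msZ mQ _ _ h0 bphi) /potential big_ord_recl /= mulrDr; congr (_ + _).
elim: m => [|m IH].
  rewrite !big_ord0 mulr0 -[RHS](ms_conservative mQ (0 : R) x h0).
  by congr (Q _ _ _); apply/funext => y; rewrite big_ord0 mulr0.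
rewrite [in RHS]big_ord_recr /= mulrDr -IH.
rewrite -(msZ mQ h x h0 (ms_iter_bounded mQ m.+1 h0 bphi)).
rewrite -(msD mQ x h0 (potential_bounded m h0 bphi) (bounded_byZ h (ms_iter_bounded mQ m.+1 h0 bphi))).
by congr (Q _ _ _); apply/funext => y; rewrite big_ord_recr /= mulrDr.
Qed.

Lemma iter_lipschitz h phi M c k : 0 < h -> bounded_by M phi ->
  lipschitz_by delta c phi ->
  lipschitz_by delta (expR (- (sigma * h)) ^+ k * c) (iter k (Q h) phi).
Proof.
move=> h0 bphi lphi; elim: k => [|k IH]; first by rewrite expr0 mul1r.
rewrite exprS -mulrA; apply: (contraction h0 _ IH).
exact: (ms_iter_bounded mQ k (ltW h0) bphi).
Qed.

(** A right-endpoint Riemann sum of the decreasing function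
exp (- sigma s) is below its integral. *)
Lemma geometric_sum_le h m : 0 < h ->
  h * \sum_(k < m) expR (- (sigma * h)) ^+ k.+1 <=
    (1 - expR (- (sigma * (m%:R * h)))) / sigma.
Proof.
move=> h0; set rho := expR (- (sigma * h)); rewrite ler_pdivlMr//.
set S := \sum_(_ < _) _; rewrite [leLHS](_ : _ = sigma * h * S); last by ring.
rewrite {}/S.
have r0 : 0 < rho by exact: expR_gt0.
have s1 : sigma * h * rho <= 1 - rho.
  have : (1 + sigma * h) * rho <= 1.
    by rewrite -[leRHS](expRxMexpNx_1 (sigma * h)) ler_wpM2r ?(ltW r0)// expR_ge1Dx.
  lra.
have -> : expR (- (sigma * (m%:R * h))) = rho ^+ m.
  by rewrite /rho -expRM_natl; congr expR; ring.
rewrite mulr_sumr.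
have -> : 1 - rho ^+ m = \sum_(k < m) (1 - rho) * rho ^+ k.
  by rewrite -mulr_sumr; have := subrX1 rho m; lra.
by apply: ler_sum => k _; rewrite exprS mulrA ler_wpM2r ?exprn_ge0 ?(ltW r0).
Qed.

Lemma potential_lipschitz h phi M c m : 0 < h -> bounded_by M phi ->
  lipschitz_by delta c phi ->
  lipschitz_by delta (c * ((1 - expR (- (sigma * (m%:R * h)))) / sigma))
    (potential h phi m).
Proof.
move=> h0 bphi lphi x y; have c0 := lipschitz_ge0 u0 lphi.
apply: (@le_trans _ _ (c * (h * \sum_(k < m) expR (- (sigma * h)) ^+ k.+1) * delta x y)).
  rewrite /potential -mulrBr normrM gtr0_norm// -sumrB.
  rewrite (mulrCA c) -mulrA ler_pM2l// (le_trans (ler_norm_sum _ _ _))//.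
  rewrite mulr_sumr mulr_suml; apply: ler_sum => k _.
  by rewrite [c * _]mulrC; exact: (iter_lipschitz k.+1 h0 bphi lphi).
by rewrite ler_wpM2r ?path_metric_ge0// ler_wpM2l// geometric_sum_le.
Qed.

(** By induction on n, each step being [one_step] for the function
h * phi + potential h phi m, whose Lipschitz constant is at most c' uniformly in m.
Killing above N leaves finitely many starting points, hence a common h0. *)
Lemma skeleton_exp_le N M c c' tau (e T : R) : 0 <= M -> 0 <= T ->
  0 < c' -> 0 < tau -> 0 < e ->
  exists2 h0, 0 < h0 & forall h n phi, 0 < h < h0 -> n%:R * h <= T ->
    bounded_by M phi -> lipschitz_by delta c phi ->
    c * (h + (1 - expR (- (sigma * T))) / sigma) <= c' ->
    forall x, (x <= N)%N ->
    skeleton Q h (fun y => expR (tau * (h * phi y)) * (y <= N)%:R) n x <=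
      expR (tau * potential h phi n x +
        n%:R * h * (2 * K * expR_remainder (tau * jump_size c') + e)).
Proof.
move=> M0 T0 c'0 tau0 e0; set B := expR_remainder _.
have [h0 h00 H] : exists2 h0, 0 < h0 & forall h F x, 0 < h < h0 ->
    bounded_by (T * M) F -> lipschitz_by delta c' F -> (x < N.+1)%N ->
    Q h (fun y => expR (tau * F y)) x <= expR (tau * Q h F x + h * (2 * K * B + e)).
  elim: N.+1 => [|n [h1 h10 H1]]; first by exists 1.
  have TM0 : 0 <= T * M by rewrite mulr_ge0.
  have [h2 h20 H2] := one_step n TM0 c'0 tau0 e0.
  exists (Num.min h1 h2); first by rewrite lt_min h10.
  move=> h F x /andP[hpos]; rewrite lt_min => /andP[hh1 hh2] bF lF.
  rewrite ltnS leq_eqVlt => /predU1P[->|xn]; first by apply: H2; rewrite ?hpos.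
  by apply: H1; rewrite ?hpos.
exists h0 => // h n phi hh nh bphi lphi cc'.
have hpos : 0 < h by case/andP: hh.
have hge0 := ltW hpos.
have c0 := lipschitz_ge0 u0 lphi.
pose a y := expR (tau * (h * phi y)) * (y <= N)%:R.
have a0 y : 0 <= a y by rewrite mulr_ge0 ?expR_ge0.
have ba : bounded_by (expR (tau * (h * M))) a.
  move=> y; rewrite normrM (gtr0_norm (expR_gt0 _)).
  apply: (@le_trans _ _ (expR (tau * (h * M)) * 1)); last by rewrite mulr1.
  rewrite ler_pM ?expR_ge0//; last by case: (y <= N)%N; rewrite ?normr1 ?normr0.
  by rewrite ler_expR ler_pM2l// ler_pM2l// (le_trans (ler_norm _)).
suff IH m : (m <= n)%N -> forall x, (x <= N)%N ->
    skeleton Q h a m x <= expR (tau * potential h phi m x + m%:R * h * (2 * K * B + e)).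
  exact: IH.
elim: m => [_ x xN|m IH mn x xN].
  by rewrite /potential big_ord0 !(mulr0, mul0r) addr0 expR0.
have mhT : m.+1%:R * h <= T.
  by apply: le_trans nh; rewrite ler_pM2r// ler_nat.
have mhT' : m%:R * h <= T.
  by apply: le_trans mhT; rewrite ler_pM2r// ler_nat.
pose G y := h * phi y + potential h phi m y.
have bG : bounded_by (T * M) G.
  move=> y; apply: (@le_trans _ _ (m.+1%:R * h * M)); last by rewrite ler_wpM2r.
  rewrite (le_trans (ler_normD _ _))// -natr1 mulrDl mul1r mulrDl addrC lerD//.
    exact: (potential_bounded m hge0 bphi).
  by rewrite normrM gtr0_norm// ler_pM2l.
have lG : lipschitz_by delta c' G.
  move=> y z; apply: (@le_trans _ _ (c * (h + (1 - expR (- (sigma * T))) / sigma) * delta y z)); last first.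
    by rewrite ler_wpM2r ?path_metric_ge0.
  have -> : G y - G z = h * (phi y - phi z) + (potential h phi m y - potential h phi m z).
    by rewrite /G; ring.
  rewrite (le_trans (ler_normD _ _))// (mulrDr c) [leRHS]mulrDl lerD//.
    by rewrite normrM gtr0_norm// [c * h]mulrC -mulrA ler_pM2l.
  apply: (le_trans (potential_lipschitz m hpos bphi lphi y z)).
  rewrite ler_wpM2r ?path_metric_ge0// ler_wpM2l// ler_pM2r ?invr_gt0//.
  by rewrite lerD2l lerN2 ler_expR lerN2 ler_pM2l.
set kap := 2 * K * B + e.
have [bN bV] := skeleton_bounded mQ m hge0 ba.
have baV : bounded_by (expR (tau * (h * M)) * bN) (fun y => a y * skeleton Q h a m y).
  by move=> y; rewrite normrM ler_pM.
have bE : bounded_by (expR (m%:R * h * kap) * expR (tau * (T * M)))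
    (fun y => expR (m%:R * h * kap) * expR (tau * G y)).
  move=> y; rewrite normrM !(gtr0_norm (expR_gt0 _)) ler_pM2l ?expR_gt0//.
  by rewrite ler_expR ler_pM2l// (le_trans (ler_norm _)).
have bE' : bounded_by (expR (tau * (T * M))) (fun y => expR (tau * G y)).
  move=> y; rewrite (gtr0_norm (expR_gt0 _)).
  by rewrite ler_expR ler_pM2l// (le_trans (ler_norm _)).
apply: (@le_trans _ _ (Q h (fun y => expR (m%:R * h * kap) * expR (tau * G y)) x)).
  apply: (ms_mono mQ x hge0 baV bE) => y; rewrite /a.
  have [yN|yN] := leqP y N; last by rewrite mulr0 mul0r mulr_ge0 ?expR_ge0.
  rewrite mulr1 /G (mulrDr tau) (expRD (tau * _)) [leRHS]mulrCA ler_pM2l ?expR_gt0//.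
  apply: (le_trans (IH (ltnW mn) y yN)).
  by rewrite expRD mulrC.
rewrite (msZ mQ _ _ hge0 bE').
apply: (@le_trans _ _ (expR (m%:R * h * kap) * expR (tau * Q h G x + h * kap))).
  by rewrite ler_pM2l ?expR_gt0//; exact: H.
rewrite -expRD ler_expR (potentialS _ _ hge0 bphi) -natr1.
lra.
Qed.

End exponential_moments.
Arguments jump_size {R} K C c.
Arguments potential {R} Q h phi m.

(** * Paths and Riemann sums *)

Section paths.
Context {R : realType} {d : measure_display} {Omega : measurableType d}.
Context {lam nu : nat -> R} {P : nat -> probability Omega R}.
Context {X : R -> {mfun Omega >-> nat}}.
Hypothesis bd : birth_death_process lam nu P X.
Implicit Types (s t r : R) (w : Omega).

Lemma path_right w t : 0 <= t ->
  exists2 e, 0 < e & forall s, t <= s < t + e -> X s w = X t w.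
Proof.
move=> t0; have := @bd_right_continuous _ _ _ _ _ _ _ bd w t t0.
move=> /(_ [set X t w]); case.
  exact: discrete_set1.
move=> e /= e0 H; exists e => // s /andP[]; rewrite le_eqVlt => /predU1P[->//|ts se].
by apply: H => //=; rewrite ltr0_norm ?subr_lt0// opprB ltrBlDl.
Qed.

Lemma path_left w t : 0 < t ->
  exists l, exists2 e, 0 < e & forall s, t - e < s < t -> X s w = l.
Proof.
move=> t0; have /cvg_ex[l /(_ [set l])] := @bd_left_limits _ _ _ _ _ _ _ bd w t t0.
case; first exact: discrete_set1.
move=> e /= e0 H; exists l, e => // s /andP[ts st].
by apply: H => //=; rewrite gtr0_norm ?subr_gt0// ltrBlDl -ltrBlDr.
Qed.

(** Near each time the path takes at most two values, its left
limit and its current value; compactness of [0, t] concludes. *)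
Lemma path_bounded w t : exists N, forall s, 0 <= s <= t -> (X s w <= N)%N.
Proof.
have /compact_near_coveringP /near_covering_withinP := @segment_compact R 0 t.
move=> /(_ nat \oo (fun N s => (X s w <= N)%N) _) [].
  move=> s; rewrite /= in_itv /= => /andP[s0 st].
  have [e e0 He] := path_right w s0.
  have [l [e' e'0 He']] : exists l, exists2 e, 0 < e &
      forall s', 0 <= s' -> s - e < s' < s -> X s' w = l.
    have [s00|s0'] := eqVneq s 0.
      by exists 0%N, 1 => // s' s'0; rewrite s00 => /andP[_]; rewrite ltNge s'0.
    have [|l [e' e'0 H]] := @path_left w s; first by rewrite lt0r s0'.
    by exists l, e' => // s' _; exact: H.
  exists ([set s' | 0 <= s' -> (X s' w <= maxn l (X s w))%N],
    [set N | (maxn l (X s w) <= N)%N]) => /=.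
    split; last by exists (maxn l (X s w)).
    exists (Num.min e e') => /=; first by rewrite lt_min e0.
    move=> s' /= + s'0; rewrite lt_min !ltr_norml => /andP[/andP[h1 h2] /andP[h3 h4]].
    have [ss'|s's] := leP s s'.
      by rewrite He ?leq_maxr// ss'/=; lra.
    by rewrite He' ?leq_maxl// s's andbT; lra.
  move=> [s' N] [/= H1 H2]; rewrite in_itv /= => /andP[s'0 _].
  exact: leq_trans (H1 s'0) H2.
move=> N _ /(_ N (leqnn N)) H; exists N => s sT.
by apply: H; rewrite /= in_itv.
Qed.

Section riemann_sums.
Variable phi : nat -> R.

(** Right endpoints are used because paths are right-continuous. *)
Definition riemann_sum (t : R) (n : nat) (w : Omega) : R :=
  t / n.+1%:R * \sum_(k < n.+1) phi (X (k.+1%:R * (t / n.+1%:R)) w).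

Lemma measurable_riemann_sum t n D : measurable_fun D (riemann_sum t n).
Proof.
apply: measurable_funM; first exact: measurable_cst.
by apply: measurable_sum => k; exact: (measurable_value X _ phi).
Qed.

Let cell (h : R) (k : nat) : set R := `]k%:R * h, k.+1%:R * h]%classic.

Let step (h : R) (n : nat) w (s : R) : R :=
  \sum_(k < n) phi (X (k.+1%:R * h) w) * \1_(cell h k) s.

(** The step function of the right-endpoint Riemann sum takes at s the value of
the path at the first grid point s' >= s. *)
Lemma step_at h n w s : 0 < h -> 0 < s <= n%:R * h ->
  exists2 s', s <= s' < s + h & s' <= n%:R * h /\ step h n w s = phi (X s' w).
Proof.
move=> h0 /andP[s0 sn].
have ex : exists k, s <= k%:R * h by exists n.
case: (ex_minnP ex) => m sm minm.
have m0 : (0 < m)%N.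
  by case: m sm {minm} => // ; rewrite mul0r leNgt s0.
case: m m0 sm minm => // k _ sk mink.
have kn : (k < n)%N by exact: mink.
have ks : k%:R * h < s.
  by rewrite ltNge; apply/negP => /mink; rewrite ltnn.
exists (k.+1%:R * h).
  by rewrite sk /= -natr1 mulrDl mul1r ltrD2r.
split; first by rewrite ler_pM2r// ler_nat.
rewrite /step (bigD1 (Ordinal kn))//= indicE mem_set; last first.
  by rewrite /cell /= in_itv /= ks.
rewrite mulr1 big1 ?addr0// => j jk.
rewrite indicE memNset ?mulr0// /cell /= in_itv /= => /andP[js sj].
have jk' : (j : nat) != k by apply: contra jk => /eqP jk; apply/eqP/val_inj.
move: jk'; rewrite neq_ltn => /orP[jk'|kj].
  have : j.+1%:R * h <= k%:R * h by rewrite ler_pM2r// ler_nat.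
  by move=> /(le_trans sj); rewrite leNgt ks.
have : k.+1%:R * h <= j%:R * h by rewrite ler_pM2r// ler_nat.
by move=> /(le_trans sk); rewrite leNgt js.
Qed.

Lemma measurable_step h n w D : measurable_fun D (step h n w).
Proof.
apply: measurable_sum => k; apply: measurable_funM; first exact: measurable_cst.
apply: measurable_indic; exact: measurable_itv.
Qed.

Local Notation mu := (@lebesgue_measure R).

Lemma integrable_on_interval t (f : R -> R) B : measurable_fun `]0, t]%classic f ->
  (forall s, `|f s| <= B) -> mu.-integrable `]0, t]%classic (EFin \o f).
Proof.
move=> mf fB; apply: measurable_bounded_integrable => //.
  have : (lebesgue_measure (`]0%R, t]%classic : set R) < +oo)%E.
    by rewrite lebesgue_measure_itv /=; case: ifP => _; rewrite ?ltry// -EFinB ltry.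
  exact.
exists B; split; first exact: num_real.
by move=> z Bz s _ /=; rewrite (le_trans (fB s))// ltW.
Qed.

Lemma integral_step h n w : 0 < h ->
  \int[mu]_(s in `]0, n%:R * h]%classic) step h n w s =
  h * \sum_(k < n) phi (X (k.+1%:R * h) w).
Proof.
move=> h0; set D := `]0, n%:R * h]%classic.
have mD : measurable D by exact: measurable_itv.
suff H m : (m <= n)%N -> \int[mu]_(s in D) step h m w s =
    h * \sum_(k < m) phi (X (k.+1%:R * h) w) by exact: H.
elim: m => [_|m IH mn].
  rewrite big_ord0 mulr0 /step (@eq_Rintegral _ _ _ mu D (fun=> 0)) => [|s _]; last by rewrite big_ord0.
  by rewrite Rintegral_cst ?mul0r.
have i1 k : mu.-integrable D (EFin \o \1_(cell h k)).
  apply: (@integrable_on_interval _ _ 1); first by apply: measurable_indic; exact: measurable_itv.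
  by move=> s; rewrite indicE; case: (s \in _); rewrite ?normr1 ?normr0.
have i2 : mu.-integrable D (EFin \o step h m w).
  apply: (@integrable_on_interval _ _ (\sum_(k < m) `|phi (X (k.+1%:R * h) w)|)).
    exact: measurable_step.
  move=> s; rewrite (le_trans (ler_norm_sum _ _ _))// ler_sum// => k _.
  rewrite normrM ler_piMr// indicE.
  by case: (s \in _); rewrite ?normr1 ?normr0.
have stepS s : step h m.+1 w s =
    step h m w s + phi (X (m.+1%:R * h) w) * \1_(cell h m) s.
  by rewrite /step big_ord_recr.
under eq_Rintegral do rewrite stepS.
rewrite RintegralD//; last first.
  have := @integrableZl _ _ _ mu D mD (phi (X (m.+1%:R * h) w)) _ (i1 m).
  by apply: eq_integrable => // s _ /=; rewrite EFinM.
rewrite IH ?(ltnW mn)// big_ord_recr /= mulrDr; congr (_ + _).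
rewrite RintegralZl// mulrC; congr (_ * _).
rewrite /Rintegral integral_indic//; last exact: measurable_itv.
rewrite (_ : cell h m `&` D = cell h m).
  have : lebesgue_measure (cell h m) = h%:E.
    rewrite /cell lebesgue_measure_itv /= lte_fin ltr_pM2r// ltr_nat ltnSn /=.
    by rewrite -EFinB -natr1 mulrDl mul1r addrAC subrr add0r.
  by move/(congr1 fine).
apply/setIidPl => s; rewrite /cell /D /= !in_itv /= => /andP[s1 s2].
rewrite (le_lt_trans _ s1) ?mulr_ge0 ?(ltW h0)//=.
by rewrite (le_trans s2)// ler_pM2r// ler_nat.
Qed.

(** The grid point s' of [step_at] tends to s from the right, where the
path is eventually constant; dominated convergence applies as paths are bounded. *)
Lemma riemann_sum_cvg t w : 0 < t ->
  riemann_sum t n w @[n --> \oo] --> \int[mu]_(s in `[0, t]) phi (X s w).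
Proof.
move=> t0; have [N HN] := path_bounded w t.
pose B := \sum_(i < N.+1) `|phi i|.
have HB s : 0 <= s <= t -> `|phi (X s w)| <= B.
  move=> /HN sN; rewrite /B (bigD1 (Ordinal (sN : (X s w < N.+1)%N)))//=.
  by rewrite lerDl sumr_ge0.
set D := `]0, t]%classic.
have mD : measurable D by exact: measurable_itv.
have h0 n : 0 < t / n.+1%:R by rewrite divr_gt0.
have nh n : n.+1%:R * (t / n.+1%:R) = t by rewrite mulrC divfK// pnatr_eq0.
have cv s : D s -> step (t / n.+1%:R) n.+1 w s @[n --> \oo] --> phi (X s w).
  rewrite /D /= in_itv /= => /andP[s0 st].
  have [e e0 He] := path_right w (ltW s0).
  have [n0 Hn0] := step_lt t0 e0.
  apply: cvg_near_cst; exists n0 => // n /= nn.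
  have := @step_at (t / n.+1%:R) n.+1 w s (h0 n).
  rewrite nh s0 st => /(_ isT) [s' /andP[ss' s'h] [_ ->]].
  rewrite He// ss' (lt_trans s'h)// ltrD2l.
  by case/andP: (Hn0 n nn).
have iD : mu.-integrable D (EFin \o (fun=> B)).
  apply: (@integrable_on_interval _ _ `|B|) => //.
have mf : measurable_fun D (fun s => phi (X s w)).
  apply: (@measurable_fun_cvg _ _ _ _ (fun n => step (t / n.+1%:R) n.+1 w)) => //.
  by move=> n; exact: measurable_step.
have cI : (\int[mu]_(s in D) (step (t / n.+1%:R) n.+1 w s)%:E)%E @[n --> \oo] -->
    (\int[mu]_(s in D) (phi (X s w))%:E)%E.
  apply: (@dominated_cvg _ _ _ mu D mD _ _ (EFin \o (fun=> B))) => //.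
  - by move=> n; apply/measurable_EFinP; exact: measurable_step.
  - by move=> s Ds; apply: cvg_EFin; [exact: nearW|exact: cv].
  - move=> n s; rewrite /D /= in_itv /= => /andP[s0 st].
    have := @step_at (t / n.+1%:R) n.+1 w s (h0 n).
    rewrite nh s0 st => /(_ isT) [s' /andP[ss' s'h] [s't ->]].
    by rewrite lee_fin HB// s't (le_trans (ltW s0)).
have iphi : mu.-integrable D (EFin \o (fun s => phi (X s w))).
  apply: (@le_integrable _ _ _ mu D mD _ (EFin \o (fun=> B))) => //.
    exact/measurable_EFinP.
  move=> s; rewrite /D /= in_itv /= => /andP[s0 st].
  by rewrite lee_fin (le_trans (HB _ _)) ?ler_norm// (ltW s0).
rewrite -(@Rintegral_itv_obnd_cbnd _ 0 (BRight t) _ iphi).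
move: cI; rewrite -[X in _ --> X]fineK; last exact: integrable_fin_num iphi.
move=> /fine_cvg; apply: cvg_trans; apply: near_eq_cvg; apply: nearW => n /=.
rewrite /riemann_sum -(@integral_step (t / n.+1%:R) n.+1 w (h0 n)).
by rewrite nh.
Qed.

End riemann_sums.

(** The union over all grids makes the event independent of the grid,
so that its probability can be made small before the step is chosen. *)
Definition skeleton_exceeds (t : R) (N : nat) : set Omega :=
  \bigcup_n \bigcup_(k in `I_n.+1) (X (k.+1%:R * (t / n.+1%:R)) @^-1` [set y | (N < y)%N]).

Lemma measurable_skeleton_exceeds t N : measurable (skeleton_exceeds t N).
Proof.
apply: bigcup_measurable => n _; apply: bigcup_measurable => k _.
exact: measurable_preimage.
Qed.

Lemma skeleton_exceeds_cvg t x : 0 < t ->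
  fine (P x (skeleton_exceeds t N)) @[N --> \oo] --> (0 : R).
Proof.
move=> t0.
have E0 : \bigcap_N skeleton_exceeds t N = set0.
  apply/seteqP; split => // w Hw; have [N HN] := path_bounded w t.
  have [n _ [k /= kn]] := Hw N I.
  rewrite ltnNge => /negP; apply; apply: HN.
  have h0 : 0 < t / n.+1%:R by rewrite divr_gt0.
  rewrite mulr_ge0 ?(ltW h0)//= mulrA ler_pdivrMr// mulrC ler_pM2l//.
  by rewrite ler_nat.
have := @nonincreasing_cvg_mu _ _ _ (P x) (skeleton_exceeds t).
rewrite E0 measure0 => /(_ _ _ _ _)/fine_cvg; apply.
- by rewrite (le_lt_trans (probability_le1 _ _)) ?ltry//; exact: measurable_skeleton_exceeds.
- by move=> N; exact: measurable_skeleton_exceeds.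
- by [].
- move=> n m nm; apply/subsetPset => w [i _ [k ki H]].
  by exists i => //; exists k => //; exact: leq_ltn_trans H.
Qed.

End paths.
Arguments riemann_sum {R d Omega} X phi t n w.
Arguments skeleton_exceeds {R d Omega} X t N.

(** * The Laplace transform of the path integral *)

(** Fatou's lemma, in the form used for every passage to the limit below. *)
Lemma fatou_le {d : measure_display} {T : measurableType d} {R : realType}
    (m : {measure set T -> \bar R}) (g_ : nat -> T -> R) (g : T -> R)
    (B_ : nat -> R) (B : R) n0 :
  (forall n, measurable_fun setT (g_ n)) -> (forall n w, 0 <= g_ n w) ->
  (forall w, g_ n w @[n --> \oo] --> g w) ->
  (forall n, (n0 <= n)%N -> (\int[m]_w (g_ n w)%:E <= (B_ n)%:E)%E) ->
  B_ n @[n --> \oo] --> B ->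
  (\int[m]_w (g w)%:E <= B%:E)%E.
Proof.
move=> mg g0 cg gB cB.
have := @fatou _ _ _ m setT measurableT (fun n w => (g_ n w)%:E).
move=> /(_ _ _)/le_trans H; rewrite (eq_integral (fun w => limn_einf (fun n => (g_ n w)%:E))); last first.
  move=> w _; have cw : (g_ n w)%:E @[n --> \oo] --> (g w)%:E.
    by apply: cvg_EFin; [exact: nearW|exact: cg].
  by rewrite (cvg_limn_einf_sup cw).
apply: H.
- by move=> n; apply/measurable_EFinP.
- by move=> n w _; rewrite lee_fin.
apply/lee_addgt0Pr => e e0; rewrite limn_einf_lim.
apply: lime_le; first exact: is_cvg_einfs.
have /cvgrPdist_le /(_ _ e0) [n1 _ Hn1] := cB.
exists (maxn n0 n1) => // n /=; rewrite geq_max => /andP[n0n n1n].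
apply: (@le_trans _ _ (\int[m]_w (g_ n w)%:E)%E).
  by apply: ereal_inf_lbound; exists n => /=.
apply: (le_trans (gB n n0n)); rewrite -EFinD lee_fin.
by have := Hn1 n n1n; rewrite ler_norml => /andP[]; lra.
Qed.

Section concentration.
Context {R : realType} {d : measure_display} {Omega : measurableType d}.
Context {lam nu u : nat -> R} {P : nat -> probability Omega R}.
Context {X : R -> {mfun Omega >-> nat}} {sigma K C : R}.
Hypothesis rates : birth_death_rates lam nu.
Hypothesis bd : birth_death_process lam nu P X.
Hypothesis erg : bd_ergodic lam nu.
Hypothesis u0 : forall x, 0 < u x.
Hypothesis sigma0 : 0 < sigma.
Hypothesis K0 : 0 < K.
Hypothesis C0 : 0 < C.
Hypothesis lamu : forall x, lam x * u x ^+ 2 <= C ^+ 2.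
Hypothesis nuu : forall x, nu x.+1 * u x ^+ 2 <= C ^+ 2.
Hypothesis Ku : forall x, K * u x ^+ 2 <= C ^+ 2.

Local Notation Q := (semigroup P X).
Local Notation pi := (bd_stationary lam nu).
Local Notation delta := (path_metric u).

Hypothesis contraction : forall t f M c, 0 < t -> bounded_by M f ->
  lipschitz_by delta c f -> lipschitz_by delta (expR (- (sigma * t)) * c) (Q t f).
Hypothesis first_moment : exists A, forall r, 0 <= r ->
  Q 1 (truncated_distance u r) 0%N <= A.

Implicit Types (f g phi : nat -> R) (M t h c tau : R) (x y n m : nat) (w : Omega).

Let mQ : markov_semigroup Q := semigroup_markov bd.

Let gQ : forall (f : nat -> R) x, bounded_fun f ->
  (Q t f x - f x) / t @[t --> (0 : R)^'+] --> bd_generator lam nu f x.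
Proof. by move=> f x; exact: (bd_has_generator bd). Qed.

Definition stationary_mean phi : R := limn (series (fun z => phi z * pi z)).

Definition stationary_distance x : R := limn (series (fun z => delta x z * pi z)).

(** The integral of exp (- sigma s) over [0, t]. *)
Definition contraction_time t : R := (1 - expR (- (sigma * t))) / sigma.

Definition path_integral phi t w : R :=
  \int[@lebesgue_measure R]_(s in `[0, t]) phi (X s w).

Lemma stationary_distance_ge0 x : 0 <= stationary_distance x.
Proof.
apply: limr_ge; first exact: (is_cvg_stationary_moment mQ gQ rates erg sigma0 contraction first_moment).
apply: nearW => n; rewrite /series /= sumr_ge0// => z _.
by rewrite mulr_ge0 ?path_metric_ge0 ?stationary_ge0.
Qed.

Lemma contraction_time_gt0 t : 0 < t -> 0 < contraction_time t.
Proof.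
by move=> t0; rewrite divr_gt0// subr_gt0 expR_lt1 oppr_lt0 mulr_gt0.
Qed.

(** The centring: each term Q_(kh) phi x is within
exp (- sigma k h) * c * stationary_distance x of the mean. *)
Lemma potential_le_mean t n phi M c x : 0 < t -> bounded_by M phi ->
  lipschitz_by delta c phi ->
  potential Q (t / n.+1%:R) phi n.+1 x <=
    t * stationary_mean phi + c * contraction_time t * stationary_distance x.
Proof.
move=> t0 bphi lphi; set h := t / _.
have h0 : 0 < h by rewrite divr_gt0.
have nh : n.+1%:R * h = t by rewrite mulrC divfK// pnatr_eq0.
clearbody h.
have c0 := lipschitz_ge0 u0 lphi.
have D0 := stationary_distance_ge0 x.
set D := stationary_distance x in D0 *.
have B k : iter k.+1 (Q h) phi x <= stationary_mean phi + expR (- (sigma * h)) ^+ k.+1 * (c * D).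
  rewrite (ms_iter mQ _ _ (ltW h0) bphi).
  have kh : 0 < k.+1%:R * h by rewrite mulr_gt0.
  have := semigroup_to_stationary mQ gQ rates erg sigma0 contraction first_moment x kh bphi lphi.
  rewrite -/(stationary_mean phi) -/(stationary_distance x) -/D => /(le_trans (ler_norm _)).
  have -> : expR (- (sigma * (k.+1%:R * h))) = expR (- (sigma * h)) ^+ k.+1.
    by rewrite -expRM_natl; congr expR; ring.
  by rewrite -mulrA; lra.
apply: (@le_trans _ _ (h * \sum_(k < n.+1) (stationary_mean phi + expR (- (sigma * h)) ^+ k.+1 * (c * D)))).
  by rewrite /potential ler_pM2l// ler_sum.
rewrite big_split /= sumr_const card_ord -mulr_suml -mulr_natl.
have := geometric_sum_le sigma0 n.+1 h0; rewrite nh -/(contraction_time t).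
set S := \sum_(_ < _) _ => HS.
rewrite [leLHS](_ : _ = n.+1%:R * h * stationary_mean phi + h * S * (c * D)); last by ring.
rewrite nh lerD2l [leRHS](_ : _ = contraction_time t * (c * D)); last by ring.
by rewrite ler_wpM2r ?mulr_ge0.
Qed.

Lemma riemann_sum_bounded t n phi M w : 0 < t -> bounded_by M phi ->
  riemann_sum X phi t n w <= t * M.
Proof.
move=> t0 bphi; rewrite /riemann_sum.
apply: (@le_trans _ _ (t / n.+1%:R * \sum_(k < n.+1) M)).
  rewrite ler_pM2l ?divr_gt0//; apply: ler_sum => k _.
  by rewrite (le_trans (ler_norm _)).
by rewrite sumr_const card_ord -[M *+ _]mulr_natl mulrA divfK// pnatr_eq0.
Qed.

(** The slack e absorbs at once the error of the generator, the excess of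
the discrete Lipschitz constant, and the probability of leaving [0, N]. *)
Definition laplace_bound (tau t c e A : R) : R :=
  expR (tau * A + t * (2 * K * expR_remainder (tau * jump_size K C (c + e)) + e)) + e.

(** On paths staying below N at the grid times, the exponential is the
product estimated by [skeleton_exp_le]; the other paths have small probability and
phi is bounded. *)
Lemma laplace_riemann x tau t phi M c (e : R) : 0 < tau -> 0 < t -> 0 < c ->
  0 < e -> bounded_by M phi -> lipschitz_by delta c phi ->
  exists n0, forall n, (n0 <= n)%N ->
  (\int[P x]_w (expR (tau * riemann_sum X phi t n w))%:E <=
    (laplace_bound tau t (c * contraction_time t) e
      (t * stationary_mean phi + c * contraction_time t * stationary_distance x))%:E)%E.
Proof.
move=> tau0 t0 c0 e0 bphi lphi.
have M0 := bounded_by_ge0 bphi.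
pose B := expR (tau * (t * M)).
have B0 : 0 < B by exact: expR_gt0.
have [N xN HN] : exists2 N, (x <= N)%N & fine (P x (skeleton_exceeds X t N)) <= e / B.
  have eB : 0 < e / B by rewrite divr_gt0.
  have /cvgrPdist_le /(_ _ eB) [N _ H] := skeleton_exceeds_cvg bd x t0.
  exists (maxn x N); first exact: leq_maxl.
  apply: le_trans (H _ (leq_maxr x N)); rewrite sub0r normrN.
  exact: ler_norm.
set c' := c * contraction_time t + e.
have c'0 : 0 < c' by rewrite ltr_wpDl// mulr_ge0 ?(ltW c0)// ltW// contraction_time_gt0.
have [h0 h00 H] := skeleton_exp_le mQ gQ rates sigma0 K0 C0 u0 lamu nuu Ku contraction
  N c M0 (ltW t0) c'0 tau0 e0.
have [n1 Hn1] := step_lt t0 h00.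
have [n2 Hn2] := step_lt t0 (divr_gt0 e0 c0).
exists (maxn n1 n2) => n; rewrite geq_max => /andP[/Hn1 hh0 /Hn2 /andP[_ hc]].
have nh : n.+1%:R * (t / n.+1%:R) = t by rewrite mulrC divfK// pnatr_eq0.
rewrite /riemann_sum; set h := t / n.+1%:R in nh hh0 hc *.
have hpos : 0 < h by case/andP: hh0.
pose a y := expR (tau * (h * phi y)) * (y <= N)%:R : R.
have a0 y : 0 <= a y by rewrite mulr_ge0 ?expR_ge0.
have ba : bounded_by (expR (tau * (h * M))) a.
  move=> y; rewrite normrM (gtr0_norm (expR_gt0 _)).
  apply: (@le_trans _ _ (expR (tau * (h * M)) * 1)); last by rewrite mulr1.
  rewrite ler_pM ?expR_ge0//; last by case: (y <= N)%N; rewrite ?normr1 ?normr0.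
  by rewrite ler_expR ler_pM2l// ler_pM2l// (le_trans (ler_norm _)).
have mB : measurable (skeleton_exceeds X t N) by exact: measurable_skeleton_exceeds.
pose Y w : R := \prod_(k < n.+1) a (X (k.+1%:R * h) w).
have Y0 w : 0 <= Y w by apply: prodr_ge0 => k _.
have mY : measurable_fun setT (EFin \o Y).
  apply/measurable_EFinP; apply: measurable_prod => k _.
  exact: (measurable_value X _ a).
(* Off the event Y is the exponential itself, on it B dominates. *)
have split_w w : expR (tau * (h * \sum_(k < n.+1) phi (X (k.+1%:R * h) w))) <=
    Y w + B * \1_(skeleton_exceeds X t N) w.
  rewrite indicE; have [wB|wB] := boolP (w \in _).
    rewrite mulr1 ler_wpDl// ler_expR ler_pM2l//.
    exact: (riemann_sum_bounded n w t0 bphi).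
  rewrite mulr0 addr0 /Y mulr_sumr mulr_sumr expR_sum ler_prod// => k _.
  have XN : (X (k.+1%:R * h) w <= N)%N.
    rewrite leqNgt; apply/negP => Nk; move/negP: wB; apply.
    by rewrite inE; exists n => //; exists k => //=.
  by rewrite expR_ge0 /a XN mulr1 /=.
have cc' : c * (h + (1 - expR (- (sigma * t))) / sigma) <= c'.
  rewrite mulrDr /c' -/(contraction_time t) addrC lerD2l.
  by rewrite mulrC -ler_pdivlMr// ltW.
have nt : n.+1%:R * h <= t by rewrite nh.
have Hs := H h n.+1 phi hh0 nt bphi lphi cc' x xN.
have Hp := potential_le_mean n x t0 bphi lphi; rewrite -/h in Hp.
apply: (@le_trans _ _ (\int[P x]_w ((Y w)%:E + B%:E * (\1_(skeleton_exceeds X t N) w)%:E))%E).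
  apply: ge0_le_integral => //.
  - apply/measurable_EFinP; apply: measurableT_comp => //.
    apply: measurable_funM; first exact: measurable_cst.
    exact: (measurable_riemann_sum phi t n).
  - apply: emeasurable_funD => //; apply: measurable_funeM.
    by apply/measurable_EFinP; exact: measurable_indic.
  - by move=> w _; rewrite -EFinM -EFinD lee_fin split_w.
have mI : measurable_fun setT (fun w => (\1_(skeleton_exceeds X t N) w)%:E : \bar R).
  by apply/measurable_EFinP; exact: measurable_indic.
rewrite ge0_integralD//; last 3 first.
- by move=> w _; rewrite lee_fin.
- by move=> w _; rewrite -EFinM lee_fin mulr_ge0 ?(ltW B0).
- exact: measurable_funeM.
rewrite ge0_integralZl//; last by rewrite lee_fin ltW.
rewrite integral_indic// setIT.
rewrite (skeleton_expectation bd x n.+1 (ltW hpos) ba a0).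
have PB : (P x (skeleton_exceeds X t N) <= (e / B)%:E)%E.
  rewrite -[leLHS]fineK ?lee_fin//.
  by rewrite ge0_fin_numE// (le_lt_trans (probability_le1 _ _))// ltry.
rewrite /laplace_bound EFinD leeD//.
  rewrite lee_fin (le_trans Hs)// ler_expR nh lerD2r ler_pM2l//.
apply: (@le_trans _ _ (B%:E * (e / B)%:E)%E); first by rewrite lee_pmul2l.
by rewrite -EFinM lee_fin mulrC divfK ?gt_eqF.
Qed.

Lemma laplace_bound_cvg tau t c A :
  laplace_bound tau t c n.+1%:R^-1 A @[n --> \oo] -->
  expR (tau * A + t * (2 * K * expR_remainder (tau * jump_size K C c))).
Proof.
have ch : (n.+1%:R^-1 : R) @[n --> \oo] --> (0 : R) by exact: cvg_harmonic.
rewrite -[X in _ --> X]addr0; apply: cvgD; last exact: ch.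
apply: continuous_cvg; first exact: continuous_expR.
apply: cvgD; first exact: cvg_cst.
apply: cvgMr; rewrite -[X in _ --> X]addr0; apply: cvgD; last exact: ch.
apply: cvgMr.
have cz : tau * jump_size K C (c + n.+1%:R^-1) @[n --> \oo] -->
    tau * jump_size K C c.
  apply: cvgMr; apply: cvgMl; apply: cvgMl.
  by rewrite -[X in _ --> X]addr0; apply: cvgD; [exact: cvg_cst|exact: ch].
apply: cvgB => //; apply: cvgB; last exact: cvg_cst.
by apply: continuous_cvg; first exact: continuous_expR.
Qed.

Lemma path_integralN t phi w : 0 < t ->
  path_integral (fun z => - phi z) t w = - path_integral phi t w.
Proof.
move=> t0; have cN := @riemann_sum_cvg _ _ _ _ _ _ _ bd (fun z => - phi z) t w t0.
apply: (cvg_unique _ cN) => //.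
rewrite (_ : (fun n => riemann_sum X (fun z => - phi z) t n w) =
    (fun n => - riemann_sum X phi t n w)).
  by apply: cvgN; exact: (@riemann_sum_cvg _ _ _ _ _ _ _ bd phi t w t0).
by apply/funext => n; rewrite /riemann_sum -mulrN -sumrN.
Qed.

Lemma measurable_path_integral t phi D : 0 < t ->
  measurable_fun D (path_integral phi t).
Proof.
move=> t0; apply: (@measurable_fun_cvg _ _ _ _ (riemann_sum X phi t)).
  by move=> n; exact: (measurable_riemann_sum phi t n).
by move=> w _; exact: (@riemann_sum_cvg _ _ _ _ _ _ _ bd phi t w t0).
Qed.

Definition laplace_limit tau t c A : R :=
  expR (tau * A + t * (2 * K * expR_remainder (tau * jump_size K C c))).

Lemma laplace_bounded x tau t phi M c : 0 < tau -> 0 < t -> 0 < c ->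
  bounded_by M phi -> lipschitz_by delta c phi ->
  (\int[P x]_w (expR (tau * path_integral phi t w))%:E <=
    (laplace_limit tau t (c * contraction_time t)
      (t * stationary_mean phi + c * contraction_time t * stationary_distance x))%:E)%E.
Proof.
move=> tau0 t0 c0 bphi lphi.
have mS : measurable_fun setT (fun w => expR (tau * path_integral phi t w)).
  apply: measurableT_comp => //; apply: measurable_funM; first exact: measurable_cst.
  exact: measurable_path_integral.
set A := t * _ + _.
apply: (@fatou_le _ _ _ (P x) (fun=> (fun w => expR (tau * path_integral phi t w))) _
  (fun n => laplace_bound tau t (c * contraction_time t) n.+1%:R^-1 A) _ 0%N) => //.
- by move=> w; exact: cvg_cst.
- move=> n _.
  have n0 : (0 : R) < n.+1%:R^-1 by rewrite invr_gt0.
  have [n1 Hn1] := laplace_riemann x tau0 t0 c0 n0 bphi lphi.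
  apply: (@fatou_le _ _ _ (P x) (fun n w => expR (tau * riemann_sum X phi t n w)) _
    (fun=> laplace_bound tau t (c * contraction_time t) n.+1%:R^-1 A) _ n1) => //.
  + move=> k; apply: measurableT_comp => //; apply: measurable_funM; first exact: measurable_cst.
    exact: (measurable_riemann_sum phi t k).
  + move=> w; apply: continuous_cvg; first exact: continuous_expR.
    by apply: cvgMr; exact: (@riemann_sum_cvg _ _ _ _ _ _ _ bd phi t w t0).
  + exact: cvg_cst.
- exact: laplace_bound_cvg.
Qed.

(** Stopping the argument at m keeps the Lipschitz constant and makes the
function bounded. *)
Definition truncate phi m : nat -> R := fun z => phi (minn z m).

(** The projection onto {0, ..., m} is 1-Lipschitz. *)
Lemma path_metric_minn m x y : delta (minn x m) (minn y m) <= delta x y.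
Proof.
wlog xy : x y / (x <= y)%N.
  by move=> H; case/orP: (leq_total x y) => /H //; rewrite path_metricC [leRHS]path_metricC.
have mono (i j k : nat) : (i <= j)%N -> (j <= k)%N -> delta i j <= delta i k.
  move=> ij jk; rewrite -(subnKC jk) -(subnKC ij) -addnA !(path_metric_add u0).
  rewrite addnA [leRHS](@big_cat_nat _ _ _ (i + (j - i))%N) ?leq_addr//=.
  by rewrite lerDl sumr_ge0// => l _; exact: ltW.
have [ym|my] := leqP y m; first by rewrite (minn_idPl (leq_trans xy ym)).
have [xm|mx] := leqP x m; last by rewrite path_metricxx path_metric_ge0.
by apply: mono => //; exact: ltnW.
Qed.

Lemma truncate_lipschitz phi c m : lipschitz_by delta c phi ->
  lipschitz_by delta c (truncate phi m).
Proof.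
move=> lphi x y; apply: le_trans (lphi _ _) _.
by rewrite ler_wpM2l ?(lipschitz_ge0 u0 lphi)// path_metric_minn.
Qed.

Lemma truncate_bounded phi m :
  bounded_by (\sum_(i < m.+1) `|phi i|) (truncate phi m).
Proof.
move=> x; rewrite /truncate.
have xm : (minn x m < m.+1)%N by rewrite ltnS geq_minr.
by rewrite (bigD1 (Ordinal xm))//= lerDl sumr_ge0.
Qed.

Lemma is_cvg_stationary_lipschitz phi c : lipschitz_by delta c phi ->
  cvgn (series (fun z => phi z * pi z)).
Proof.
move=> lphi; have c0 := lipschitz_ge0 u0 lphi.
apply: normed_cvg.
apply: (@series_le_cvg _ _ (fun z => `|phi 0%N| * pi z + c * (delta 0 z * pi z))).
- by move=> z; exact: normr_ge0.
- move=> z; have p0 := stationary_ge0 rates erg z.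
  by apply: addr_ge0; apply: mulr_ge0 => //; rewrite mulr_ge0 ?path_metric_ge0.
- move=> z; rewrite /= normrM (ger0_norm (stationary_ge0 rates erg z)) mulrA -mulrDl.
  rewrite ler_wpM2r ?stationary_ge0//.
  have := lphi z 0%N; rewrite path_metricC; have := ler_normD (phi 0%N) (phi z - phi 0%N).
  by rewrite addrC subrK; lra.
- rewrite (_ : series _ = series (fun z => `|phi 0%N| * pi z) + series (fun z => c * (delta 0 z * pi z))).
    apply: is_cvgD; apply: is_cvg_seriesZ.
      by apply/cvg_ex; eexists; exact: (cvg_stationary rates erg).
    exact: (is_cvg_stationary_moment mQ gQ rates erg sigma0 contraction first_moment).
  by apply/funext => n; rewrite fctE /series /= -big_split.
Qed.

(** The difference phi - truncate phi m vanishes below m and is at most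
c * delta 0 z beyond, so the tail of the first moment of pi bounds the error. *)
Lemma truncate_mean_cvg phi c : lipschitz_by delta c phi ->
  stationary_mean (truncate phi m) @[m --> \oo] --> stationary_mean phi.
Proof.
move=> lphi; have c0 := lipschitz_ge0 u0 lphi.
have cD : cvgn (series (fun z => delta 0 z * pi z)).
  exact: (is_cvg_stationary_moment mQ gQ rates erg sigma0 contraction first_moment).
pose s := series (fun z => delta 0 z * pi z).
have D0 z : 0 <= delta 0 z * pi z by rewrite mulr_ge0 ?path_metric_ge0 ?stationary_ge0.
have key m : `|stationary_mean phi - stationary_mean (truncate phi m)| <= c * (stationary_distance 0 - s m).
  have c1 : `|series (fun z => phi z * pi z) n -
      series (fun z => truncate phi m z * pi z) n| @[n --> \oo] -->
      `|stationary_mean phi - stationary_mean (truncate phi m)|.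
    apply: cvg_norm; apply: cvgB; first exact: (is_cvg_stationary_lipschitz lphi).
    exact: (is_cvg_stationary_lipschitz (truncate_lipschitz m lphi)).
  have c2 : c * (s n - s m) @[n --> \oo] --> c * (stationary_distance 0 - s m).
    by apply: cvgMr; apply: cvgB; [exact: cD|exact: cvg_cst].
  apply: (ler_cvg_to c1 c2); exists m => // n /= mn.
  rewrite /s /series /= -sumrB (@big_cat_nat _ _ _ m)//= big1_seq ?add0r; last first.
    move=> z; rewrite mem_index_iota => /andP[_ /andP[_ zm]].
    by rewrite /truncate (minn_idPl (ltnW zm)) subrr.
  rewrite [in leRHS](@big_cat_nat _ _ _ m)//= addrAC subrr add0r mulr_sumr.
  rewrite (le_trans (ler_norm_sum _ _ _))// big_nat [leRHS]big_nat.
  apply: ler_sum => z /andP[mz _].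
  rewrite -mulrBl normrM (ger0_norm (stationary_ge0 rates erg z)) mulrA.
  rewrite ler_wpM2r ?stationary_ge0//.
  rewrite /truncate (minn_idPr mz) (le_trans (lphi _ _))// ler_wpM2l//.
  rewrite -(subnKC mz) path_metricC (path_metric_add u0) -{2}(add0n (m + _)%N).
  rewrite (path_metric_add u0) add0n [leRHS](@big_cat_nat _ _ _ m) ?leq_addr//=.
  by rewrite lerDr sumr_ge0// => i _; exact: ltW.
have cz : c * (stationary_distance 0 - s m) @[m --> \oo] --> (0 : R).
  rewrite -(mulr0 c) -(subrr (stationary_distance 0)).
  by apply: cvgMr; apply: cvgB; [exact: cvg_cst|exact: cD].
apply/cvgrPdist_le => e e0.
have /cvgrPdist_le /(_ _ e0) := cz; apply: filterS => m.
rewrite sub0r normrN => /(le_trans (ler_norm _)).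
exact: le_trans.
Qed.

Lemma laplace_lipschitz x tau t phi c : 0 < tau -> 0 < t -> 0 < c ->
  lipschitz_by delta c phi ->
  (\int[P x]_w (expR (tau * path_integral phi t w))%:E <=
    (laplace_limit tau t (c * contraction_time t)
      (t * stationary_mean phi + c * contraction_time t * stationary_distance x))%:E)%E.
Proof.
move=> tau0 t0 c0 lphi.
apply: (@fatou_le _ _ _ (P x) (fun m w => expR (tau * path_integral (truncate phi m) t w)) _
  (fun m => laplace_limit tau t (c * contraction_time t)
      (t * stationary_mean (truncate phi m) + c * contraction_time t * stationary_distance x)) _ 0%N).
- move=> m; apply: measurableT_comp => //; apply: measurable_funM; first exact: measurable_cst.
  exact: measurable_path_integral.
- by move=> m w; exact: expR_ge0.
- move=> w; have [N HN] := path_bounded bd w t.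
  apply: cvg_near_cst; exists N => // m /= Nm; congr (expR (_ * _)).
  apply: eq_Rintegral => s; rewrite inE /= in_itv /= => st.
  by rewrite /truncate (minn_idPl (leq_trans (HN s st) Nm)).
- move=> m _; apply: (laplace_bounded x tau0 t0 c0 (truncate_bounded phi m)).
  exact: truncate_lipschitz.
- rewrite /laplace_limit; apply: continuous_cvg; first exact: continuous_expR.
  apply: cvgD; last exact: cvg_cst.
  apply: cvgMr; apply: cvgD; last exact: cvg_cst.
  by apply: cvgMr; exact: (truncate_mean_cvg lphi).
Qed.

(** Chernoff's bound, with the minimiser tau given by
tau * b = ln (1 + v). *)
Lemma path_integral_upper_tail x t phi c (y : R) : 0 < t -> 0 < c -> 0 < y ->
  lipschitz_by delta c phi ->
  (P x [set w | t * stationary_mean phi +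
       c * contraction_time t * stationary_distance x + t * y <= path_integral phi t w]%R <=
   (expR (- (2 * K * t * poisson_rate (y / (2 * K * jump_size K C (c * contraction_time t))))))%:E)%E.
Proof.
move=> t0 c0 y0 lphi; set A := t * _ + _; set b := jump_size _ _ _.
have b0 : 0 < b.
  have := mulr_gt0 c0 (contraction_time_gt0 t0).
  by move=> ct0; rewrite /b /jump_size divr_gt0 ?sqrtr_gt0 ?(mulr_gt0 ct0).
set v := y / _.
have v0 : 0 < v by rewrite /v divr_gt0// (mulr_gt0 (mulr_gt0 (ltr0n R 2) K0)).
pose tau := ln (1 + v) / b.
have lv : 0 < ln (1 + v) by rewrite ln_gt0// ltrDl.
have tau0 : 0 < tau by rewrite divr_gt0.
pose thr := A + t * y.
have mS : measurable_fun setT (path_integral phi t).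
  exact: measurable_path_integral.
set E := [set w | _].
have mE : measurable E.
  rewrite (_ : E = path_integral phi t @^-1` `[thr, +oo[%classic).
    by rewrite -[_ @^-1` _]setTI; apply: mS => //; exact: measurable_itv.
  by apply/seteqP; split => w; rewrite /E /= in_itv /= andbT.
have mexp : measurable_fun setT (fun w => (expR (tau * path_integral phi t w))%:E : \bar R).
  apply/measurable_EFinP; apply: measurableT_comp => //.
  by apply: measurable_funM => //; exact: measurable_cst.
have H := laplace_lipschitz x tau0 t0 c0 lphi; rewrite -/A in H.
apply: (@le_trans _ _ ((expR (- (tau * thr)))%:E *
    \int[P x]_w (expR (tau * path_integral phi t w))%:E)%E).
  rewrite -ge0_integralZl//.
  have -> : P x E = (\int[P x]_w (\1_E w)%:E)%E by rewrite integral_indic// setIT.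
  apply: ge0_le_integral => //.
  - by apply/measurable_EFinP; exact: measurable_indic.
  - exact: measurable_funeM.
  - move=> w _; rewrite -EFinM -expRD lee_fin indicE.
    have [|_] := boolP (w \in E); last exact: expR_ge0.
    rewrite inE /E /= -/thr => Hw.
    by rewrite -[leLHS]expR0 ler_expR addrC subr_ge0 ler_pM2l.
apply: (le_trans (lee_wpmul2l _ H)); first by rewrite lee_fin expR_ge0.
rewrite -EFinM lee_fin /laplace_limit -expRD ler_expR /thr.
rewrite -/b /expR_remainder /poisson_rate.
have -> : tau * b = ln (1 + v) by rewrite /tau divfK// gt_eqF.
rewrite lnK ?posrE ?addr_gt0//.
have yE : tau * y = 2 * K * (v * ln (1 + v)).
  by rewrite /tau /v -/b; field; rewrite !gt_eqF.
have : - (tau * (A + t * y)) = - (tau * A) - t * (tau * y) by ring.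
move=> ->; rewrite yE; lra.
Qed.

End concentration.
Arguments stationary_mean {R} lam nu phi.
Arguments stationary_distance {R} lam nu u x.
Arguments contraction_time {R} sigma t.
Arguments path_integral {R d Omega} X phi t w.

(** * The deviation inequality *)

Theorem corollary4p7 (R : realType) (d : measure_display)
    (Omega : measurableType d) (lam nu : nat -> R)
    (P : nat -> probability Omega R) (X : R -> {mfun Omega >-> nat})
    (u : nat -> R) (sigma K C : R) (phi : nat -> R) :
  let delta := path_metric u in
  let pi := bd_stationary lam nu in
  let L := fine (lip_norm delta phi) in
  birth_death_rates lam nu ->
  birth_death_process lam nu P X ->
  bd_ergodic lam nu ->
  (forall x, 0 < u x) ->
  (forall (t : R) (x : nat), 0 < t ->
     wasserstein_space delta (distribution (P x) (X t))) ->
  wasserstein_curvature delta P X = sigma%:E ->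
  sigma%:E = ereal_inf (range (fun x => (bd_curvature_at lam nu u x)%:E)) ->
  0 < sigma ->
  0 < K ->
  0 < C ->
  K <= Num.min (inf (range lam)) (inf (range (fun x => nu x.+1))) ->
  (forall x, u x <= C * Num.min (Num.sqrt (nu x.+1))^-1 (Num.sqrt (lam x))^-1) ->
  (lip_norm delta phi < +oo)%E ->
  forall (x : nat) (t y : R), 0 < t -> 0 < y ->
  let M := (1 - expR (- (sigma * t))) * L / (sigma * t) *
           limn (series (fun z => delta x z * pi z)) in
  (P x [set w | (y + M <=
      `| time_average X phi t w - limn (series (fun z => (phi z * pi z)%R)) |)%R]
   <= (if L == 0 then 0 else
       2 * expR (- (2 * K * t *
         poisson_rate (y * sigma /
           (2 * Num.sqrt K * C * (1 - expR (- (sigma * t))) * L)))))%:E)%E.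
Proof.
move=> delta pi L rates bd erg u0 wass curv _ sigma0 K0 C0 KK uC Lfin x t y t0 y0; cbv zeta.
set M : R := _ / (sigma * t) * _.
have lamK z : K <= lam z.
  apply: le_trans KK _; rewrite ge_min; apply/orP; left.
  apply: ge_inf; last by exists z.
  by exists 0 => _ [i _ <-]; exact/ltW/(bd_birth_gt0 rates).
have lamu z : lam z * u z ^+ 2 <= C ^+ 2.
  have l0 := bd_birth_gt0 rates z; have s0 : 0 < Num.sqrt (lam z) by rewrite sqrtr_gt0.
  rewrite -{1}(sqr_sqrtr (ltW l0)) -exprMn mulrC.
  rewrite ler_pXn2r ?nnegrE ?mulr_ge0 ?(ltW C0) ?(ltW (u0 z)) ?(ltW s0)//.
  rewrite -ler_pdivlMr//; apply: le_trans (uC z) _.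
  by rewrite ler_pM2l// ge_min lexx orbT.
have nuu z : nu z.+1 * u z ^+ 2 <= C ^+ 2.
  have l0 := bd_death_gt0 rates z; have s0 : 0 < Num.sqrt (nu z.+1) by rewrite sqrtr_gt0.
  rewrite -{1}(sqr_sqrtr (ltW l0)) -exprMn mulrC.
  rewrite ler_pXn2r ?nnegrE ?mulr_ge0 ?(ltW C0) ?(ltW (u0 z)) ?(ltW s0)//.
  rewrite -ler_pdivlMr//; apply: le_trans (uC z) _.
  by rewrite ler_pM2l// ge_min lexx.
have Ku z : K * u z ^+ 2 <= C ^+ 2.
  by apply: le_trans (lamu z); rewrite ler_pM2r ?exprn_gt0.
have lphi : lipschitz_by delta L phi := lip_norm_fine u0 Lfin.
have contr := curvature_contraction bd u0 sigma0 curv.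
have mom := first_moment_bound wass.
have pi0 z : 0 <= pi z := stationary_ge0 rates erg z.
(* A constant phi has both averages equal to that constant, and M = 0 < y. *)
have [L0|L0] := eqVneq L 0.
  have phi0 : phi = (fun=> phi 0%N) by move: lphi; rewrite L0 => /(lipschitz0).
  have M0 : M = 0 by rewrite /M L0 mulr0 mul0r mul0r.
  rewrite (_ : [set w | _] = set0) ?measure0//.
  rewrite -subset0 => w; rewrite /= M0 addr0 leNgt => /negP; apply.
  suff -> : time_average X phi t w - limn (series (fun z => phi z * pi z)) = 0 by rewrite normr0.
  apply/eqP; rewrite subr_eq0; apply/eqP.
  transitivity (phi 0%N).
    rewrite /time_average phi0 Rintegral_cst// [X in _ * (_ * fine X)]lebesgue_measure_itv /=.
    by rewrite lte_fin t0 /= subr0 mulrC mulfK ?gt_eqF.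
  rewrite phi0; apply/esym/cvg_lim => //.
  rewrite -[X in _ --> X]mulr1.
  have : phi 0%N * series pi n @[n --> \oo] --> phi 0%N * 1.
    by apply: cvgMr; exact: (cvg_stationary rates erg).
  apply: cvg_trans; apply: near_eq_cvg; apply: nearW => n.
  by rewrite /series /= mulr_sumr.
have Lpos : 0 < L by rewrite lt0r L0 (lipschitz_ge0 u0 lphi).
pose ct := contraction_time sigma t.
pose D := stationary_distance lam nu u x.
pose mean := stationary_mean lam nu.
have ct0 : 0 < ct := contraction_time_gt0 sigma0 t0.
have tM : t * M = L * ct * D.
  have -> : M = (1 - expR (- (sigma * t))) * L / (sigma * t) * D by [].
  rewrite /ct /contraction_time; move: (D) (L) (expR _) => D' L' ex.
  by field; rewrite !gt_eqF.
set v := y * sigma / _.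
have vE : y / (2 * K * jump_size K C (L * ct)) = v.
  rewrite /v /jump_size /ct /contraction_time.
  (* K / sqrt K = sqrt K reconciles the two forms of the argument. *)
  have K2 : K = Num.sqrt K * Num.sqrt K by rewrite -expr2 sqr_sqrtr// ltW.
  have sK : Num.sqrt K != 0 by rewrite gt_eqF// sqrtr_gt0.
  have e1 : 1 - expR (- (sigma * t)) != 0.
    by rewrite gt_eqF// subr_gt0 expR_lt1 oppr_lt0 mulr_gt0.
  rewrite [X in 2 * X * _]K2; field.
  by rewrite L0 !gt_eqF// ?sqrtr_gt0// subr_gt0 expR_lt1 oppr_lt0 mulr_gt0.
have tail psi : lipschitz_by delta L psi ->
    (P x [set w | t * mean psi + L * ct * D + t * y <= path_integral X psi t w]%R <=
     (expR (- (2 * K * t * poisson_rate v)))%:E)%E.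
  move=> lpsi; rewrite -vE.
  exact: (path_integral_upper_tail rates bd erg u0 sigma0 K0 C0 lamu nuu Ku contr mom x t0 Lpos y0 lpsi).
have lNphi : lipschitz_by delta L (fun z => - phi z).
  by move=> a b; rewrite -opprD normrN; exact: lphi.
have meanN : mean (fun z => - phi z) = - mean phi.
  rewrite /mean /stationary_mean.
  rewrite (_ : series _ = - series (fun z => phi z * pi z)).
    by apply: limN; exact: (is_cvg_stationary_lipschitz rates bd erg u0 sigma0 contr mom lphi).
  by apply/funext => n; rewrite fctE /series /= -sumrN; apply: eq_bigr => z _; rewrite mulNr.
have mS psi : measurable_fun setT (path_integral X psi t).
  exact: (measurable_path_integral bd).
have mE psi r : measurable [set w | r <= path_integral X psi t w].
  rewrite (_ : [set w | _] = path_integral X psi t @^-1` `[r, +oo[%classic).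
    by rewrite -[_ @^-1` _]setTI; apply: mS => //; exact: measurable_itv.
  by apply/seteqP; split => w; rewrite /= in_itv /= andbT.
pose E1 := [set w | t * mean phi + L * ct * D + t * y <= path_integral X phi t w].
pose E2 := [set w | t * mean (fun z => - phi z) + L * ct * D + t * y <=
  path_integral X (fun z => - phi z) t w].
rewrite (_ : [set w | _] = E1 `|` E2).
  apply: (@le_trans _ _ (P x E1 + P x E2)%E); first by apply: measureU2; exact: mE.
  apply: (le_trans (leeD (tail phi lphi) (tail _ lNphi))).
  rewrite -EFinD lee_fin -/v /=; set e := expR _; lra.
apply/seteqP; split => w; rewrite /E1 /E2 /= meanN (path_integralN bd _ _ t0) -tM;
  rewrite -/(stationary_mean lam nu phi) -/mean;
  have -> : path_integral X phi t w = t * time_average X phi t w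
    by [rewrite /time_average mulrA divff ?mul1r// gt_eqF];
  rewrite mulrN -[- (t * time_average _ _ _ _)]mulrN -[- (t * mean phi)]mulrN;
  rewrite -!mulrDr !ler_pM2l// ler_normr.
- by move=> /orP[H|H]; [left|right]; move: H; lra.
- by move=> [H|H]; apply/orP; [left|right]; move: H; lra.
Qed.
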